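(* Let $\alpha\in(0,1)\setminus\mathbb{Q}$ and let $p_s/q_s$, $s\geq 0$, be the convergents to $\alpha$ given by its continued fraction expansion. If $n\geq 1$ is an integer with $q_s\leq n<q_{s+1}$, then $$\max\left\{\frac{n^2\log n}{2}-n^2,\ \left[\frac{n}{q_s}\right]\log q_{s+1}-n\right\}\leq e_n(\alpha)\leq \frac{n^2\log n}{2}+9n^2+\frac{n}{q_s}\log q_{s+1},$$ where $[x]$ denotes the greatest integer $\leq x$.
   Context: Let $\Delta$ be the closed unit disk in $\mathbb{C}$ and $\Delta^2$ the closed unit bidisk in $\mathbb{C}^2$. Let $\mathcal{P}_n$ be the space of polynomials $P\in\mathbb{C}[z,w]$ of total degree at most $n$. For $\alpha\in(0,1)\setminus\mathbb{Q}$ let $K=\{(e^z,e^{\alpha z}):\ |z|\leq 1\}\subset\mathbb{C}^2$, and for a set $A$ let $\|P\|_A=\sup_A|P|$. Define $E_n(\alpha)=\sup\{\|P\|_{\Delta^2}:\ P\in\mathcal{P}_n,\ \|P\|_K\leq 1\}$ (finite) and $e_n(\alpha)=\log E_n(\alpha)$. Continued fractions: $\alpha=[a_0;a_1,a_2,\dots]$ with integers $a_j$, $a_j\geq1$ for $j\geq1$; the convergents $p_s/q_s=[a_0;a_1,\dots,a_s]$ satisfy $p_s=a_sp_{s-1}+p_{s-2}$, $q_s=a_sq_{s-1}+q_{s-2}$ for $s\geq1$, with $p_0=a_0$, $q_0=1$, $p_{-1}=1$, $q_{-1}=0$. *)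

(* Defs.v *)
From Stdlib Require Import Reals ZArith.
Open Scope R_scope.

Definition C : Type := (R * R)%type.
Definition Cadd (u v : C) : C := (fst u + fst v, snd u + snd v).
Definition Cmul (u v : C) : C :=
  (fst u * fst v - snd u * snd v, fst u * snd v + snd u * fst v).
Definition Cscal (r : R) (u : C) : C := (r * fst u, r * snd u).
Definition C0 : C := (0, 0).
Definition C1 : C := (1, 0).
Definition Cmod (u : C) : R := sqrt (fst u ^ 2 + snd u ^ 2).
Fixpoint Cpow (u : C) (k : nat) : C :=
  match k with O => C1 | S k' => Cmul u (Cpow u k') end.
Definition Cexp (u : C) : C := (exp (fst u) * cos (snd u), exp (fst u) * sin (snd u)).

Fixpoint Csum (f : nat -> C) (m : nat) : C :=
  match m with O => C0 | S m' => Cadd (Csum f m') (f m') end.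

(* ---------- Polynomials in C[z,w] of total degree <= n ----------
   A polynomial P in P_n is given by its coefficients c i j (i+j <= n):
   P(z,w) = sum_{i+j<=n} c i j z^i w^j.  Coefficients with i+j>n are ignored. *)
Definition poly_eval (n : nat) (c : nat -> nat -> C) (z w : C) : C :=
  Csum (fun i => Csum (fun j => Cmul (c i j) (Cmul (Cpow z i) (Cpow w j))) (S (n - i))) (S n).

Definition in_K (alpha : R) (z w : C) : Prop :=
  exists u : C, Cmod u <= 1 /\ z = Cexp u /\ w = Cexp (Cscal alpha u).

Definition in_bidisk (z w : C) : Prop := Cmod z <= 1 /\ Cmod w <= 1.

Definition normK_le1 (alpha : R) (n : nat) (c : nat -> nat -> C) : Prop :=
  forall z w, in_K alpha z w -> Cmod (poly_eval n c z w) <= 1.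

(* Values whose supremum is E_n(alpha):
   sup_{P in P_n, ||P||_K <= 1} ||P||_{Delta^2}
   = sup { |P(z,w)| : P in P_n, ||P||_K <= 1, (z,w) in Delta^2 }. *)
Definition En_set (alpha : R) (n : nat) (t : R) : Prop :=
  exists c : nat -> nat -> C, normK_le1 alpha n c /\
    exists z w, in_bidisk z w /\ t = Cmod (poly_eval n c z w).

Fixpoint cf_x (alpha : R) (k : nat) : R :=
  match k with
  | O => alpha
  | S k' => / (cf_x alpha k' - IZR (Int_part (cf_x alpha k')))
  end.
Definition cf_a (alpha : R) (k : nat) : Z := Int_part (cf_x alpha k).

(* cf_qpair alpha s = (q_{s-1}, q_s), with q_{-1}=0, q_0=1,
   q_s = a_s q_{s-1} + q_{s-2}. *)
Fixpoint cf_qpair (alpha : R) (s : nat) : Z * Z :=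
  match s with
  | O => (0%Z, 1%Z)
  | S s' => let (qm, q) := cf_qpair alpha s' in (q, (cf_a alpha (S s') * q + qm)%Z)
  end.
Definition cf_q (alpha : R) (s : nat) : Z := snd (cf_qpair alpha s).

(* Main.v *)
(** Restricted to the curve, a polynomial of degree at most [n] is the exponential
    sum [f(u) = sum c_ij exp((i + j alpha) u)].

    Upper bound: Cauchy's inequalities bound the moments
    [sum c_ij (i + j alpha)^k = f^(k)(0)] by [k!]; combining them with the coefficients of
    the Lagrange polynomial that isolates one frequency bounds each [c_ij] by a quotient
    whose denominator is a product of differences of frequencies.  Each row of this
    product (fixed difference [l] of the exponents of [w]) costs a factorial times the
    distance of [l alpha] to the integers, and the best approximation property of the
    convergents leaves at most [n / q_s] indices [l] for which this distance can be
    small, where it is still at least [1 / (2 q_(s+1))].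

    Lower bounds: a nonzero polynomial for which [f] vanishes at [0] to order
    [dim P_n - 1], and a power of [z^(p_s) - w^(q_s)], which is small on the curve
    because [|q_s alpha - p_s| <= 1 / q_(s+1)]. *)
Require Import Defs.
From Stdlib Require Import Reals ZArith Lra Lia Psatz List Permutation.
From Coquelicot Require Import Coquelicot.
Import ListNotations.
Open Scope R_scope.

(** * Finite sums and the complex exponential *)

(** The supremum on the bidisk and the largest coefficient agree up to the factor [N = dim P_n], so
    the whole question concerns the coefficients of [f]. With [M = N - 1], about [n^2 / 2], the
    polynomial isolating one frequency is controlled by [(M + n)^M], whose logarithm is about
    [n^2 log n]. The product of the factorials [m!] over the rows, divided out, takes back
    [n^2 log n / 2]. Vanishing of order [M] in the lower bound yields [M! / n^M], with the same
    balance; hence the common leading term. The arithmetic of [alpha] enters through a single factor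
    per row, the one nearest to zero. An ordinary row loses at most [log (4 q_s)], and since
    [q_s <= n] all rows together lose [O(n log n)], which the term [9 n^2] absorbs; only the
    exceptional rows produce [log q_(s+1)]. Cauchy's inequalities are obtained without contour
    integrals: a coefficient of a polynomial is an average over roots of unity, and this is applied
    to Taylor polynomials whose remainder tends to zero. *)

Definition lsum {A : Type} (f : A -> C) (l : list A) : C :=
  fold_right (fun x s => (f x + s)%C) (RtoC 0) l.

Definition lsumR {A : Type} (f : A -> R) (l : list A) : R :=
  fold_right (fun x s => f x + s) 0 l.

Definition lprod {A : Type} (f : A -> R) (l : list A) : R :=
  fold_right (fun x s => f x * s) 1 l.

Lemma lsum_app {A : Type} (f : A -> C) (l1 l2 : list A) :
  lsum f (l1 ++ l2) = (lsum f l1 + lsum f l2)%C.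
Proof.
  induction l1 as [|x l1 IH]; simpl; [ring|]. rewrite IH; ring.
Qed.

Lemma lsum_ext {A : Type} (f g : A -> C) (l : list A) :
  (forall x, In x l -> f x = g x) -> lsum f l = lsum g l.
Proof.
  induction l as [|x l IH]; simpl; intros H; [reflexivity|].
  rewrite IH by auto. rewrite H by auto. reflexivity.
Qed.

Lemma lsum_map {A B : Type} (h : A -> B) (f : B -> C) (l : list A) :
  lsum f (map h l) = lsum (fun x => f (h x)) l.
Proof. induction l as [|x l IH]; simpl; [reflexivity|]; now rewrite IH. Qed.

Lemma lsum_plus {A : Type} (f g : A -> C) (l : list A) :
  lsum (fun x => f x + g x)%C l = (lsum f l + lsum g l)%C.
Proof. induction l as [|x l IH]; simpl; [ring|]; rewrite IH; ring. Qed.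

Lemma lsum_scal {A : Type} (a : C) (f : A -> C) (l : list A) :
  lsum (fun x => a * f x)%C l = (a * lsum f l)%C.
Proof. induction l as [|x l IH]; simpl; [ring|]; rewrite IH; ring. Qed.

Lemma lsum_minus {A : Type} (f g : A -> C) (l : list A) :
  lsum (fun x => f x - g x)%C l = (lsum f l - lsum g l)%C.
Proof. induction l as [|x l IH]; simpl; [ring|]; rewrite IH; ring. Qed.

Lemma lsum_zero {A : Type} (f : A -> C) (l : list A) :
  (forall x, In x l -> f x = RtoC 0) -> lsum f l = RtoC 0.
Proof.
  induction l as [|x l IH]; simpl; intros H; [reflexivity|].
  rewrite IH, H by auto. ring.
Qed.

Lemma lsum_exchange {A B : Type} (f : A -> B -> C) (l : list A) (m : list B) :
  lsum (fun x => lsum (f x) m) l = lsum (fun y => lsum (fun x => f x y) l) m.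
Proof.
  induction l as [|x l IH]; simpl.
  - symmetry; now apply lsum_zero.
  - now rewrite IH, <- lsum_plus.
Qed.

Lemma lsum_perm {A : Type} (f : A -> C) (l1 l2 : list A) :
  Permutation l1 l2 -> lsum f l1 = lsum f l2.
Proof.
  induction 1; simpl; [reflexivity|congruence|ring|congruence].
Qed.

Lemma lsum_single {A : Type} (f : A -> C) (l : list A) (x : A) :
  NoDup l -> In x l -> (forall y, In y l -> y <> x -> f y = RtoC 0) ->
  lsum f l = f x.
Proof.
  intros Hnd Hin H0.
  destruct (in_split _ _ Hin) as (l1 & l2 & ->).
  rewrite (lsum_perm f _ (x :: l1 ++ l2))
    by (symmetry; apply Permutation_middle).
  simpl. rewrite lsum_zero; [ring|].
  apply NoDup_remove_2 in Hnd.
  intros y Hy. apply H0; [|now intros ->].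
  apply in_app_iff in Hy; apply in_app_iff; simpl; tauto.
Qed.

Lemma lsumR_le {A : Type} (f g : A -> R) (l : list A) :
  (forall x, In x l -> f x <= g x) -> lsumR f l <= lsumR g l.
Proof.
  induction l as [|x l IH]; simpl; intros H; [lra|].
  apply Rplus_le_compat; auto.
Qed.

Lemma lsumR_scal {A : Type} (a : R) (f : A -> R) (l : list A) :
  lsumR (fun x => a * f x) l = a * lsumR f l.
Proof. induction l as [|x l IH]; simpl; [ring|]; rewrite IH; ring. Qed.

Lemma lsumR_const {A : Type} (a : R) (l : list A) :
  lsumR (fun _ => a) l = INR (length l) * a.
Proof.
  induction l as [|x l IH]; [simpl; ring|].
  cbn [lsumR fold_right length].
  unfold lsumR in IH. rewrite IH, S_INR. ring.
Qed.

Lemma Cmod_lsum {A : Type} (f : A -> C) (l : list A) :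
  Cmod (lsum f l) <= lsumR (fun x => Cmod (f x)) l.
Proof.
  induction l as [|x l IH]; simpl; [rewrite Cmod_0; lra|].
  eapply Rle_trans; [apply Cmod_triangle|]. lra.
Qed.

Lemma Cmod_lsum_le {A : Type} (f : A -> C) (B : R) (l : list A) :
  (forall x, In x l -> Cmod (f x) <= B) -> Cmod (lsum f l) <= INR (length l) * B.
Proof.
  intros H. eapply Rle_trans; [apply Cmod_lsum|].
  rewrite <- lsumR_const. now apply lsumR_le.
Qed.

Lemma lsum_seq_S (f : nat -> C) (m : nat) :
  lsum f (seq 0 (S m)) = (lsum f (seq 0 m) + f m)%C.
Proof. rewrite seq_S, lsum_app. simpl. ring. Qed.

Lemma Csum_lsum (f : nat -> C) (m : nat) : Csum f m = lsum f (seq 0 m).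
Proof.
  induction m as [|m IH]; [reflexivity|].
  rewrite lsum_seq_S, <- IH. reflexivity.
Qed.

(* [Defs.Cexp], retyped in Coquelicot's [C], where [ring] applies. *)
Definition cexp (u : C) : C := Cexp u.

Lemma cexp_add (u v : C) : cexp (u + v)%C = (cexp u * cexp v)%C.
Proof.
  destruct u as [a b], v as [c d]; unfold cexp, Cexp, Cplus, Cmult; simpl.
  rewrite exp_plus, cos_plus, sin_plus. f_equal; ring.
Qed.

Lemma cexp_0 : cexp (RtoC 0) = RtoC 1.
Proof.
  unfold cexp, Cexp, RtoC; simpl. rewrite exp_0, cos_0, sin_0. f_equal; ring.
Qed.

Lemma cexp_pow (u : C) (k : nat) : (cexp u ^ k)%C = cexp (INR k * u)%C.
Proof.
  induction k as [|k IH].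
  - simpl Cpow. replace (INR 0 * u)%C with (RtoC 0) by (simpl INR; ring).
    now rewrite cexp_0.
  - rewrite Cpow_S, IH, <- cexp_add. f_equal.
    rewrite S_INR, RtoC_plus. ring.
Qed.

Lemma Cmod_cexp (u : C) : Cmod (cexp u) = exp (fst u).
Proof.
  unfold Cmod, cexp; simpl.
  replace (_ + _) with ((exp (fst u)) ^ 2).
  - rewrite sqrt_pow2; [reflexivity|left; apply exp_pos].
  - pose proof (sin2_cos2 (snd u)) as H. unfold Rsqr in H.
    transitivity (exp (fst u) ^ 2 * (sin (snd u) * sin (snd u) + cos (snd u) * cos (snd u))).
    rewrite H; ring. ring.
Qed.

(* Project onto the direction [g 1 - g 0] to reduce to the real mean value theorem. *)
Lemma Cmod_increment_le (g1 g2 h1 h2 phi psi : R -> R) :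
  (forall t, 0 <= t <= 1 -> is_derive g1 t (h1 t)) ->
  (forall t, 0 <= t <= 1 -> is_derive g2 t (h2 t)) ->
  (forall t, 0 <= t <= 1 -> is_derive phi t (psi t)) ->
  (forall t, 0 <= t <= 1 -> Cmod (h1 t, h2 t) <= psi t) ->
  Cmod (g1 1 - g1 0, g2 1 - g2 0) <= phi 1 - phi 0.
Proof.
  intros H1 H2 Hphi Hle.
  set (v1 := g1 1 - g1 0). set (v2 := g2 1 - g2 0).
  set (v := Cmod (v1, v2)).
  assert (Hv : v * v = v1 * v1 + v2 * v2).
  { unfold v, Cmod; simpl. rewrite sqrt_sqrt; nra. }
  assert (Hv0 : 0 <= v) by apply Cmod_ge_0.
  set (F := fun t => v * phi t - (v1 * g1 t + v2 * g2 t)).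
  assert (HF : forall t, 0 <= t <= 1 ->
    is_derive F t (v * psi t - (v1 * h1 t + v2 * h2 t))).
  { intros t Ht. unfold F.
    apply (is_derive_minus (V := R_NormedModule)).
    - apply (is_derive_scal (fun t => phi t) t v); auto.
    - apply (is_derive_plus (V := R_NormedModule)).
      + apply (is_derive_scal (fun t => g1 t) t v1); auto.
      + apply (is_derive_scal (fun t => g2 t) t v2); auto. }
  destruct (MVT_gen F 0 1 (fun t => v * psi t - (v1 * h1 t + v2 * h2 t))) as (c & Hc & Heq).
  - rewrite Rmin_left, Rmax_right by lra. intros; apply HF; lra.
  - rewrite Rmin_left, Rmax_right by lra. intros x Hx.
    apply derivable_continuous_pt. exists (v * psi x - (v1 * h1 x + v2 * h2 x)).
    apply is_derive_Reals, HF, Hx.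
  - rewrite Rmin_left, Rmax_right in Hc by lra.
    assert (Hcs : v1 * h1 c + v2 * h2 c <= v * Cmod (h1 c, h2 c)).
    { unfold v, Cmod; simpl. rewrite <- sqrt_mult by nra.
      apply Rle_trans with (1 := Rle_abs _). rewrite <- sqrt_Rsqr_abs.
      apply sqrt_le_1_alt. unfold Rsqr.
      pose proof (Rle_0_sqr (v1 * h2 c - v2 * h1 c)) as Hs. unfold Rsqr in Hs. nra. }
    pose proof (Hle c Hc) as Hp.
    assert (0 <= F 1 - F 0) by (rewrite Heq; nra).
    unfold F in H.
    assert (v * v <= v * (phi 1 - phi 0)).
    { rewrite Hv. fold v1 in H. unfold v1, v2 in *. nra. }
    (* Needed when [v = 0], where the inequality just proved cannot be divided by [v]. *)
    assert (0 <= phi 1 - phi 0).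
    { destruct (MVT_gen phi 0 1 psi) as (d & Hd & Hdeq).
      - rewrite Rmin_left, Rmax_right by lra. intros; apply Hphi; lra.
      - rewrite Rmin_left, Rmax_right by lra. intros x Hx.
        apply derivable_continuous_pt. exists (psi x).
        apply is_derive_Reals, Hphi, Hx.
      - rewrite Rmin_left, Rmax_right in Hd by lra.
        pose proof (Hle d Hd). pose proof (Cmod_ge_0 (h1 d, h2 d)). lra. }
    destruct (Rle_lt_dec v 0); [lra|]. nra.
Qed.

(** * Taylor polynomials of the complex exponential and their remainder *)

Definition texp (m : nat) (u : C) : C :=
  lsum (fun k => / INR (fact k) * u ^ k)%C (seq 0 m).

Lemma texp_S (m : nat) (u : C) :
  texp (S m) u = (texp m u + / INR (fact m) * u ^ m)%C.
Proof. apply lsum_seq_S. Qed.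

Lemma fst_scal (a : R) (u : C) : fst (a * u)%C = a * fst u.
Proof. simpl; ring. Qed.

Lemma snd_scal (a : R) (u : C) : snd (a * u)%C = a * snd u.
Proof. simpl; ring. Qed.

Lemma INR_fact_pos (k : nat) : 0 < INR (fact k).
Proof. apply lt_0_INR, lt_O_fact. Qed.

Lemma texp_term (m : nat) (t : R) (u : C) :
  (/ INR (fact m) * (t * u) ^ m)%C = (RtoC (/ INR (fact m) * t ^ m) * u ^ m)%C.
Proof.
  pose proof (INR_fact_pos m).
  rewrite Cpow_mult_l, RtoC_mult, RtoC_pow, RtoC_inv by lra. ring.
Qed.

Lemma is_derive_monomial (c : R) (m : nat) (t : R) :
  is_derive (fun t : R => c * t ^ S m) t (c * (INR (S m) * t ^ m)).
Proof.
  auto_derive; [trivial|].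
  change (c * (1 * (INR (S m) * t ^ m)) = c * (INR (S m) * t ^ m)). ring.
Qed.

Lemma INR_fact_S (m : nat) : INR (fact (S m)) = INR (S m) * INR (fact m).
Proof. rewrite fact_simpl, mult_INR. reflexivity. Qed.

(** Differentiating along the ray [t u] lowers the number of terms by one, which is what the
    induction for the remainder consumes. Real and imaginary parts are kept apart so that only real
    derivatives occur. *)
Lemma texp_derive (m : nat) (u : C) (t : R) :
  is_derive (fun t : R => fst (texp (S m) (t * u)%C)) t (fst (u * texp m (t * u))%C) /\
  is_derive (fun t : R => snd (texp (S m) (t * u)%C)) t (snd (u * texp m (t * u))%C).
Proof.
  induction m as [|m [IH1 IH2]].
  - assert (E : forall t : R, texp 1 (t * u)%C = RtoC 1).
    { intros s. unfold texp; simpl. field. }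
    split.
    + apply (is_derive_ext (fun _ => 1)); [intros; now rewrite E|].
      unfold texp, lsum; simpl fold_right. replace (fst _) with 0 by (simpl; ring).
      apply (is_derive_const (V := R_NormedModule)).
    + apply (is_derive_ext (fun _ => 0)); [intros; now rewrite E|].
      unfold texp, lsum; simpl fold_right. replace (snd _) with 0 by (simpl; ring).
      apply (is_derive_const (V := R_NormedModule)).
  - assert (D : is_derive (fun t : R => / INR (fact (S m)) * t ^ S m) t (/ INR (fact m) * t ^ m)).
    { replace (/ INR (fact m) * t ^ m) with (/ INR (fact (S m)) * (INR (S m) * t ^ m)).
      - apply is_derive_monomial.
      - rewrite INR_fact_S. pose proof (INR_fact_pos m). pose proof (pos_INR m).
        rewrite S_INR. field. split; lra. }
    assert (F : (u * (/ INR (fact m) * (t * u) ^ m))%C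
       = (RtoC (/ INR (fact m) * t ^ m) * u ^ S m)%C).
    { rewrite texp_term, Cpow_S. ring. }
    split.
    + apply (is_derive_ext (fun s : R => fst (texp (S m) (s * u)%C) +
        fst (u ^ S m)%C * (/ INR (fact (S m)) * s ^ S m))).
      { intros s. rewrite (texp_S (S m)), texp_term.
        transitivity (fst (texp (S m) (s * u)%C) +
          fst (RtoC (/ INR (fact (S m)) * s ^ S m) * u ^ S m)%C); [|reflexivity].
        rewrite fst_scal. now rewrite (Rmult_comm (fst _)). }
      rewrite texp_S, Cmult_plus_distr_l, F.
      change (fst (?x + ?y)%C) with (fst x + fst y). rewrite fst_scal, (Rmult_comm _ (fst _)).
      apply (is_derive_plus (V := R_NormedModule)); [exact IH1|].
      apply (is_derive_scal (fun s => / INR (fact (S m)) * s ^ S m)), D.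
    + apply (is_derive_ext (fun s : R => snd (texp (S m) (s * u)%C) +
        snd (u ^ S m)%C * (/ INR (fact (S m)) * s ^ S m))).
      { intros s. rewrite (texp_S (S m)), texp_term.
        transitivity (snd (texp (S m) (s * u)%C) +
          snd (RtoC (/ INR (fact (S m)) * s ^ S m) * u ^ S m)%C); [|reflexivity].
        rewrite snd_scal. now rewrite (Rmult_comm (snd _)). }
      rewrite texp_S, Cmult_plus_distr_l, F.
      change (snd (?x + ?y)%C) with (snd x + snd y). rewrite snd_scal, (Rmult_comm _ (snd _)).
      apply (is_derive_plus (V := R_NormedModule)); [exact IH2|].
      apply (is_derive_scal (fun s => / INR (fact (S m)) * s ^ S m)), D.
Qed.

Lemma cexp_derive (u : C) (t : R) :
  is_derive (fun t : R => fst (cexp (t * u)%C)) t (fst (u * cexp (t * u))%C) /\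
  is_derive (fun t : R => snd (cexp (t * u)%C)) t (snd (u * cexp (t * u))%C).
Proof.
  destruct u as [a b]. unfold cexp, Cexp, Cmult, RtoC; simpl.
  split; auto_derive; trivial; unfold Rminus; ring.
Qed.

Lemma Re_le_Cmod (u : C) : fst u <= Cmod u.
Proof. apply Rle_trans with (1 := Rle_abs _), re_le_Cmod. Qed.

(** Along the ray [t u], the derivative of the remainder with [m + 1] terms is [u] times the
    remainder with [m] terms. The induction hypothesis bounds it by a multiple of [t^m], and
    [Cmod_increment_le] integrates this from 0 to 1. *)
Lemma cexp_taylor (m : nat) (u : C) :
  Cmod (cexp u - texp m u)%C <= Cmod u ^ m / INR (fact m) * exp (Cmod u).
Proof.
  revert u; induction m as [|m IH]; intros u.
  - unfold texp; simpl. replace (cexp u - 0)%C with (cexp u) by ring.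
    rewrite Cmod_cexp. pose proof (Re_le_Cmod u) as [H|H].
    + apply exp_increasing in H. lra.
    + rewrite H. lra.
  - set (r := Cmod u).
    assert (Hr : 0 <= r) by apply Cmod_ge_0.
    pose proof (Cmod_increment_le
      (fun t => fst (cexp (t * u)%C) - fst (texp (S m) (t * u)%C))
      (fun t => snd (cexp (t * u)%C) - snd (texp (S m) (t * u)%C))
      (fun t => fst (u * cexp (t * u))%C - fst (u * texp m (t * u))%C)
      (fun t => snd (u * cexp (t * u))%C - snd (u * texp m (t * u))%C)
      (fun t => r ^ S m / INR (fact (S m)) * exp r * t ^ S m)
      (fun t => r * (r ^ m / INR (fact m) * exp r) * t ^ m)) as H.
    lapply H; [clear H; intros H|].
    2:{ intros t _. apply (is_derive_minus (V := R_NormedModule)); [apply cexp_derive|apply texp_derive]. }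
    lapply H; [clear H; intros H|].
    2:{ intros t _. apply (is_derive_minus (V := R_NormedModule)); [apply cexp_derive|apply texp_derive]. }
    lapply H; [clear H; intros H|].
    2:{ intros t _.
      replace (r * (r ^ m / INR (fact m) * exp r) * t ^ m)
        with (r ^ S m / INR (fact (S m)) * exp r * (INR (S m) * t ^ m)).
      - apply is_derive_monomial.
      - rewrite INR_fact_S. pose proof (INR_fact_pos m). pose proof (pos_INR m).
        rewrite S_INR. simpl pow. field. split; lra. }
    lapply H; [clear H; intros H|].
    2:{ intros t Ht.
      replace (_, _) with (u * (cexp (t * u) - texp m (t * u)))%C.
      2:{ generalize (cexp (t * u)) (texp m (t * u)%C). intros [a b] [c d]; destruct u as [p q].
          unfold Cmult, Cminus, Cplus, Copp; simpl. f_equal; ring. }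
      rewrite Cmod_mult. fold r. rewrite Rmult_assoc.
      apply Rmult_le_compat_l; [exact Hr|].
      eapply Rle_trans; [apply IH|].
      rewrite Cmod_mult, Cmod_R, Rabs_pos_eq by lra. fold r.
      rewrite Rpow_mult_distr.
      assert (exp (t * r) <= exp r).
      { destruct (Rle_lt_or_eq_dec (t * r) r) as [Hlt|He]; [nra| |].
        - left; now apply exp_increasing. - rewrite He; lra. }
      pose proof (INR_fact_pos m). pose proof (exp_pos (t * r)).
      assert (0 <= t ^ m) by (apply pow_le; lra).
      assert (0 <= r ^ m) by (apply pow_le; lra).
      replace (t ^ m * r ^ m / INR (fact m) * exp (t * r))
        with ((r ^ m / INR (fact m)) * t ^ m * exp (t * r)) by (field; lra).
      replace (r ^ m / INR (fact m) * exp r * t ^ m)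
        with ((r ^ m / INR (fact m)) * t ^ m * exp r) by (field; lra).
      apply Rmult_le_compat_l; [|assumption].
      apply Rmult_le_pos; [|assumption]. apply Rdiv_le_0_compat; lra. }
    assert (Z1 : cexp (RtoC 0 * u)%C = RtoC 1) by (rewrite Cmult_0_l; apply cexp_0).
    assert (Z2 : texp (S m) (RtoC 0 * u)%C = RtoC 1).
    { clear. induction m as [|m IHm].
      - unfold texp; simpl. field.
      - rewrite texp_S, IHm. simpl Cpow. ring. }
    rewrite Z1, Z2 in H. rewrite Cmult_1_l in H.
    replace (cexp u - texp (S m) u)%C with
      (fst (cexp u) - fst (texp (S m) u) - (fst (RtoC 1) - fst (RtoC 1)),
       snd (cexp u) - snd (texp (S m) u) - (snd (RtoC 1) - snd (RtoC 1))).
    2:{ generalize (cexp u) (texp (S m) u). intros [a b] [c d].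
        unfold Cminus, Cplus, Copp; simpl. f_equal; ring. }
    eapply Rle_trans; [exact H|].
    rewrite pow1, pow_i by lia. lra.
Qed.

Lemma cexp_2PI_Z (k : Z) : cexp (0, 2 * PI * IZR k) = RtoC 1.
Proof.
  unfold cexp, Cexp; simpl. rewrite exp_0.
  assert (H : forall j : nat, cos (2 * PI * INR j) = 1 /\ sin (2 * PI * INR j) = 0).
  { intros j. pose proof (cos_period 0 j). pose proof (sin_period 0 j).
    rewrite cos_0 in H. rewrite sin_0 in H0.
    replace (2 * PI * INR j) with (0 + 2 * INR j * PI) by ring. auto. }
  assert (E : IZR k = INR (Z.to_nat k) - INR (Z.to_nat (- k))).
  { rewrite !INR_IZR_INZ, <- minus_IZR. f_equal. lia. }
  rewrite E, Rmult_minus_distr_l, cos_minus, sin_minus.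
  destruct (H (Z.to_nat k)) as [-> ->], (H (Z.to_nat (- k))) as [-> ->].
  unfold RtoC; f_equal; ring.
Qed.

Lemma cos_lt_1 (x : R) : 0 < Rabs x < 2 * PI -> cos x < 1.
Proof.
  intros H. replace x with (2 * (x / 2)) by field.
  rewrite cos_2a_sin.
  assert (sin (x / 2) <> 0).
  { destruct (Rcase_abs x) as [Hx|Hx].
    - rewrite Rabs_left in H by lra.
      replace (x / 2) with (- (- x / 2)) by field. rewrite sin_neg.
      pose proof (sin_gt_0 (- x / 2)). lra.
    - rewrite Rabs_right in H by lra.
      pose proof (sin_gt_0 (x / 2)). lra. }
  pose proof (Rsqr_pos_lt _ H0). unfold Rsqr in H1. lra.
Qed.

(** * Roots of unity (with integer exponents, to allow negative powers) and extraction of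
    coefficients *)

Definition omega (m : nat) (r : Z) : C := cexp (0, 2 * PI * IZR r / INR m).

Lemma omega_add (m : nat) (r s : Z) : omega m (r + s) = (omega m r * omega m s)%C.
Proof.
  unfold omega. rewrite <- cexp_add. f_equal. unfold Cplus; simpl.
  rewrite plus_IZR. f_equal; unfold Rdiv; ring.
Qed.

Lemma omega_pow (m : nat) (r : Z) (k : nat) :
  (omega m r ^ k)%C = omega m (r * Z.of_nat k).
Proof.
  unfold omega. rewrite cexp_pow. f_equal. unfold Cmult; simpl.
  rewrite mult_IZR, <- INR_IZR_INZ. f_equal; unfold Rdiv; ring.
Qed.

Lemma Cmod_omega (m : nat) (r : Z) : Cmod (omega m r) = 1.
Proof. unfold omega. rewrite Cmod_cexp. apply exp_0. Qed.

(** Geometric sum: multiplied by [omega m r - 1] it telescopes to zero, and that factor is nonzero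
    because the angle is not a multiple of [2 PI]. *)
Lemma omega_sum (m : nat) (r : Z) :
  (0 < Z.abs r < Z.of_nat m)%Z ->
  lsum (fun a => omega m (r * Z.of_nat a)) (seq 0 m) = RtoC 0.
Proof.
  intros Hr.
  assert (Hm : 0 < INR m) by (apply lt_0_INR; lia).
  assert (G : forall k, ((omega m r - 1) *
     lsum (fun a => omega m (r * Z.of_nat a)) (seq 0 k) = omega m (r * Z.of_nat k) - 1)%C).
  { induction k as [|k IH].
    - simpl. rewrite Z.mul_0_r. unfold omega.
      replace (2 * PI * IZR 0 / INR m) with (2 * PI * IZR 0) by (simpl; field; lra).
      rewrite cexp_2PI_Z. ring.
    - rewrite lsum_seq_S, Cmult_plus_distr_l, IH.
      replace (r * Z.of_nat (S k))%Z with (r + r * Z.of_nat k)%Z by lia.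
      rewrite omega_add. ring. }
  specialize (G m).
  assert (E : omega m (r * Z.of_nat m) = RtoC 1).
  { unfold omega. rewrite mult_IZR, <- INR_IZR_INZ.
    replace (2 * PI * (IZR r * INR m) / INR m) with (2 * PI * IZR r) by (field; lra).
    apply cexp_2PI_Z. }
  rewrite E in G.
  assert (N : omega m r <> RtoC 1).
  { intros H. apply (f_equal fst) in H. unfold omega, cexp, Cexp, RtoC in H; cbn [fst snd] in H.
    rewrite exp_0, Rmult_1_l in H.
    enough (cos (2 * PI * IZR r / INR m) < 1) by lra.
    apply cos_lt_1. pose proof PI_RGT_0.
    assert (Ha : 1 <= Rabs (IZR r)) by (rewrite <- abs_IZR; apply IZR_le; lia).
    assert (Hb : Rabs (IZR r) < INR m)
      by (rewrite <- abs_IZR, INR_IZR_INZ; apply IZR_lt; lia).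
    replace (Rabs (2 * PI * IZR r / INR m)) with (2 * PI * (Rabs (IZR r) / INR m)).
    2:{ unfold Rdiv. rewrite !Rabs_mult, Rabs_inv, (Rabs_pos_eq 2), (Rabs_pos_eq PI), (Rabs_pos_eq (INR m)) by lra. ring. }
    assert (0 < Rabs (IZR r) / INR m < 1).
    { split; [apply Rdiv_lt_0_compat; lra|]. apply Rmult_lt_reg_r with (INR m); [lra|].
      unfold Rdiv; rewrite Rmult_assoc, Rinv_l; lra. }
    nra. }
  destruct (Ceq_dec (lsum (fun a => omega m (r * Z.of_nat a)) (seq 0 m)) 0) as [|Hne]; [assumption|].
  exfalso. refine (Cmult_neq_0 (omega m r - 1)%C _ _ Hne _).
  - intros H. apply N. replace (omega m r) with (omega m r - 1 + 1)%C by ring. rewrite H; ring.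
  - rewrite G. ring.
Qed.

(* Average [p(z) z^(-k)] over the [m]-th roots of unity. *)
Lemma coef_le_sup (m : nat) (a : nat -> C) (k : nat) :
  (k < m)%nat ->
  exists z, Cmod z = 1 /\ Cmod (a k) <= Cmod (lsum (fun i => a i * z ^ i)%C (seq 0 m)).
Proof.
  intros Hk.
  set (p := fun z => lsum (fun i => a i * z ^ i)%C (seq 0 m)).
  set (F := fun b => (omega m (- Z.of_nat k * Z.of_nat b) * p (omega m (Z.of_nat b)))%C).
  assert (E : lsum F (seq 0 m) = (INR m * a k)%C).
  { transitivity (lsum (fun b => lsum (fun i =>
      a i * omega m ((Z.of_nat i - Z.of_nat k) * Z.of_nat b))%C (seq 0 m)) (seq 0 m)).
    { apply lsum_ext; intros b _. unfold F, p. rewrite <- lsum_scal.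
      apply lsum_ext; intros i _. rewrite omega_pow.
      replace ((Z.of_nat i - Z.of_nat k) * Z.of_nat b)%Z
        with (- Z.of_nat k * Z.of_nat b + Z.of_nat b * Z.of_nat i)%Z by ring.
      rewrite omega_add. ring. }
    rewrite lsum_exchange.
    rewrite (lsum_single _ _ k).
    - rewrite lsum_scal. rewrite Z.sub_diag.
      rewrite (lsum_ext _ (fun _ => RtoC 1)).
      + rewrite (Cmult_comm (INR m)). f_equal. rewrite <- (length_seq m 0) at 2.
        induction (seq 0 m); cbn [lsum fold_right length]; [reflexivity|].
        fold (lsum (fun _ : nat => RtoC 1) l). rewrite IHl, S_INR, RtoC_plus. ring.
      + intros x _. unfold omega. simpl. rewrite Rmult_0_r. unfold Rdiv; rewrite Rmult_0_l.
        apply cexp_0.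
    - apply seq_NoDup.
    - apply in_seq; lia.
    - intros i Hi Hne. apply in_seq in Hi. rewrite lsum_scal, omega_sum by lia. ring. }
  (* By [E] the average of [F] is [a k], so not all its values can be smaller than [a k] in
     modulus. *)
  destruct (List.Exists_dec (fun b => Cmod (a k) <= Cmod (p (omega m (Z.of_nat b)))) (seq 0 m))
    as [H|H]; [intros; apply Rle_dec| |].
  - apply Exists_exists in H. destruct H as (b & _ & Hb).
    exists (omega m (Z.of_nat b)). split; [apply Cmod_omega|exact Hb].
  - exfalso.
    assert (Hm : 0 < INR m) by (apply lt_0_INR; lia).
    assert (Hlt : lsumR (fun b => Cmod (F b)) (seq 0 m) < INR m * Cmod (a k)).
    { assert (G : forall b, In b (seq 0 m) -> Cmod (F b) < Cmod (a k)).
      { intros b Hb. unfold F. rewrite Cmod_mult, Cmod_omega, Rmult_1_l.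
        apply Rnot_le_lt. intros Hle. apply H. apply Exists_exists. eauto. }
      revert G. rewrite <- (length_seq m 0) at 2.
      assert (Hne : seq 0 m <> []) by (destruct m; [lia|discriminate]).
      revert Hne. clear. generalize (Cmod (a k)) as s. generalize (seq 0 m) as l.
      induction l as [|x l IH]; intros s Hne G; [congruence|].
      rewrite length_cons, S_INR. simpl lsumR.
      pose proof (G x (or_introl eq_refl)).
      destruct l as [|y l]; [simpl; lra|].
      assert (lsumR (fun b => Cmod (F b)) (y :: l) < INR (length (y :: l)) * s).
      { apply IH; [discriminate|]. intros b Hb; apply G; now right. }
      unfold lsumR in *. lra. }
    pose proof (Cmod_lsum F (seq 0 m)) as Hs.
    rewrite E, Cmod_mult, Cmod_R, Rabs_pos_eq in Hs by lra. lra.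
Qed.

(** * Exponential sums with bounded values *)

Definition expsum {A : Type} (c : A -> C) (lam : A -> R) (T : list A) (u : C) : C :=
  lsum (fun x => c x * cexp (lam x * u))%C T.

Definition moment {A : Type} (c : A -> C) (lam : A -> R) (T : list A) (k : nat) : C :=
  lsum (fun x => c x * RtoC (lam x ^ k))%C T.

(** Regrouping by powers of [u] turns the moments into Taylor coefficients. The upper bound reads
    this as Cauchy's inequality, the first lower bound as vanishing at the origin. *)
Lemma texp_moments {A : Type} (c : A -> C) (lam : A -> R) (T : list A) (m : nat) (u : C) :
  lsum (fun x => c x * texp m (lam x * u))%C T =
  lsum (fun k => / INR (fact k) * moment c lam T k * u ^ k)%C (seq 0 m).
Proof.
  unfold texp, moment.
  rewrite (lsum_ext _ (fun x => lsum (fun k =>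
    (/ INR (fact k) * (c x * RtoC (lam x ^ k)) * u ^ k)%C) (seq 0 m))).
  - rewrite lsum_exchange. apply lsum_ext; intros k _.
    rewrite (lsum_ext _ (fun x => (/ INR (fact k) * u ^ k) * (c x * RtoC (lam x ^ k)))%C)
      by (intros; ring).
    rewrite lsum_scal. ring.
  - intros x _. rewrite <- lsum_scal. apply lsum_ext; intros k _.
    rewrite Cpow_mult_l, RtoC_pow. ring.
Qed.

Lemma exp_le_compat (x y : R) : x <= y -> exp x <= exp y.
Proof. intros [H| ->]; [left; now apply exp_increasing|right; reflexivity]. Qed.

Lemma expsum_taylor {A : Type} (c : A -> C) (lam : A -> R) (T : list A) (r : R)
  (m : nat) (u : C) :
  (forall x, In x T -> 0 <= lam x <= r) -> Cmod u <= 1 ->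
  Cmod (expsum c lam T u - lsum (fun x => c x * texp m (lam x * u))%C T)%C <=
  lsumR (fun x => Cmod (c x)) T * (r ^ m / INR (fact m) * exp r).
Proof.
  intros Hlam Hu. unfold expsum. rewrite <- lsum_minus.
  eapply Rle_trans; [apply Cmod_lsum|].
  rewrite Rmult_comm, <- lsumR_scal. apply lsumR_le; intros x Hx.
  replace (c x * cexp (lam x * u) - c x * texp m (lam x * u))%C
    with (c x * (cexp (lam x * u) - texp m (lam x * u)))%C by ring.
  rewrite Cmod_mult, Rmult_comm. apply Rmult_le_compat_r; [apply Cmod_ge_0|].
  eapply Rle_trans; [apply cexp_taylor|].
  destruct (Hlam x Hx).
  assert (0 <= Cmod (lam x * u)%C <= r).
  { split; [apply Cmod_ge_0|]. rewrite Cmod_mult, Cmod_R, Rabs_pos_eq by lra.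
    pose proof (Cmod_ge_0 u). nra. }
  apply Rmult_le_compat.
  - apply Rdiv_le_0_compat; [apply pow_le; lra|apply INR_fact_pos].
  - left; apply exp_pos.
  - apply Rmult_le_compat_r; [left; apply Rinv_0_lt_compat, INR_fact_pos|].
    apply pow_incr; lra.
  - apply exp_le_compat; lra.
Qed.

(** [coef_le_sup] is applied to the Taylor polynomial with [m] terms, which differs from the
    exponential sum by at most [B r^m / m!] on the unit circle; then [m] tends to infinity. *)
Lemma moment_bound {A : Type} (c : A -> C) (lam : A -> R) (T : list A) (r : R) :
  (forall x, In x T -> 0 <= lam x <= r) ->
  (forall u, Cmod u <= 1 -> Cmod (expsum c lam T u) <= 1) ->
  forall k, Cmod (moment c lam T k) <= INR (fact k).
Proof.
  intros Hlam Hf k.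
  set (S := lsumR (fun x => Cmod (c x)) T).
  set (B := S * exp r).
  assert (H : forall m, (k < m)%nat ->
    Cmod (moment c lam T k) / INR (fact k) <= 1 + B * (r ^ m / INR (fact m))).
  { intros m Hm.
    destruct (coef_le_sup m (fun k => / INR (fact k) * moment c lam T k)%C k Hm) as (z & Hz & Hle).
    rewrite <- texp_moments in Hle.
    pose proof (INR_fact_pos k) as Hk.
    rewrite <- RtoC_inv, Cmod_mult, Cmod_R, Rabs_pos_eq in Hle by (try (left; now apply Rinv_0_lt_compat); lra).
    unfold Rdiv at 1. rewrite Rmult_comm.
    eapply Rle_trans; [exact Hle|].
    pose proof (expsum_taylor c lam T r m z Hlam (Req_le _ _ Hz)) as Ht. fold S in Ht.
    pose proof (Hf z (Req_le _ _ Hz)) as H1.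
    set (p := lsum _ T) in *. set (q := expsum c lam T z) in *.
    replace p with (q + - (q - p))%C by ring.
    eapply Rle_trans; [apply Cmod_triangle|]. rewrite Cmod_opp.
    unfold B. nra. }
  pose proof (INR_fact_pos k) as Hk.
  enough (Cmod (moment c lam T k) / INR (fact k) <= 1) as H1.
  { apply Rmult_le_compat_r with (r := INR (fact k)) in H1; [|lra].
    unfold Rdiv in H1. rewrite Rmult_assoc, Rinv_l, Rmult_1_r, Rmult_1_l in H1 by lra. exact H1. }
  apply le_epsilon. intros eps Heps.
  (* The added 1 keeps the divisor positive when [B] vanishes. *)
  assert (HB : 0 < Rabs B + 1) by (pose proof (Rabs_pos B); lra).
  destruct (cv_speed_pow_fact r (eps / (Rabs B + 1))) as (N & HN).
  { apply Rdiv_lt_0_compat; lra. }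
  set (m := Nat.max N (k + 1)).
  specialize (HN m ltac:(lia)). specialize (H m ltac:(lia)).
  unfold Rdist in HN. rewrite Rminus_0_r in HN.
  eapply Rle_trans; [exact H|]. apply Rplus_le_compat_l.
  eapply Rle_trans; [apply Rle_abs|]. rewrite Rabs_mult.
  set (y := Rabs (r ^ m / INR (fact m))) in *.
  assert (y * (Rabs B + 1) < eps).
  { apply Rmult_lt_reg_r with (/ (Rabs B + 1)); [now apply Rinv_0_lt_compat|].
    rewrite Rmult_assoc, Rinv_r, Rmult_1_r by lra. exact HN. }
  assert (0 <= y) by apply Rabs_pos. nra.
Qed.

(** A factor [lam x - y] splits into a shift of the moment index, which costs [a + 1 <= M], and a
    multiplication by [y], which costs at most [r]. Letting [a] vary in the induction avoids
    expanding the product into elementary symmetric functions. *)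
Lemma lagrange_functional_bound {A : Type} (c : A -> C) (lam : A -> R) (T : list A)
  (r : R) (M : nat) :
  0 <= r ->
  (forall k, Cmod (moment c lam T k) <= INR (fact k)) ->
  forall xs a, (forall y, In y xs -> 0 <= y <= r) -> (a + length xs <= M)%nat ->
  Cmod (lsum (fun x => c x * RtoC (lam x ^ a * lprod (fun y => lam x - y) xs)%R)%C T)
    <= INR (fact a) * (INR M + r) ^ length xs.
Proof.
  intros Hr Hmom. induction xs as [|y xs IH]; intros a Hxs Ha.
  - simpl. rewrite Rmult_1_r.
    rewrite (lsum_ext _ (fun x => c x * RtoC (lam x ^ a))%C); [apply Hmom|].
    intros x _. now rewrite Rmult_1_r.
  - rewrite (lsum_ext _ (fun x =>
      c x * RtoC (lam x ^ S a * lprod (fun y => lam x - y) xs)%R -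
      RtoC y * (c x * RtoC (lam x ^ a * lprod (fun y => lam x - y) xs)%R))%C).
    2:{ intros x _. simpl. rewrite !RtoC_mult, RtoC_minus. ring. }
    rewrite lsum_minus, lsum_scal.
    simpl length in *.
    assert (Hxs' : forall y, In y xs -> 0 <= y <= r) by (intros; apply Hxs; now right).
    pose proof (IH (S a) Hxs' ltac:(lia)) as H1.
    pose proof (IH a Hxs' ltac:(lia)) as H2.
    destruct (Hxs y (or_introl eq_refl)) as [Hy0 Hy1].
    unfold Cminus. eapply Rle_trans; [apply Cmod_triangle|].
    rewrite Cmod_opp, Cmod_mult, Cmod_R, (Rabs_pos_eq y) by lra.
    rewrite INR_fact_S in H1.
    assert (HM : INR (S a) <= INR M) by (apply le_INR; lia).
    assert (0 <= (INR M + r) ^ length xs) by (apply pow_le; pose proof (pos_INR M); lra).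
    pose proof (INR_fact_pos a).
    set (X := (INR M + r) ^ length xs) in *. set (F := INR (fact a)) in *.
    simpl pow. fold X.
    assert (0 <= F * X) by nra.
    set (m2 := Cmod (lsum _ T)) in H2 |- *.
    assert (y * m2 <= r * (F * X)).
    { apply Rmult_le_compat; try assumption. apply Cmod_ge_0. }
    assert (INR (S a) * (F * X) <= INR M * (F * X)) by (apply Rmult_le_compat_r; lra).
    eapply Rle_trans; [apply Rplus_le_compat; [exact H1|eassumption]|].
    replace (F * ((INR M + r) * X)) with (INR M * (F * X) + r * (F * X)) by ring.
    lra.
Qed.

Lemma lprod_eq_0 {A : Type} (f : A -> R) (l : list A) (x : A) :
  In x l -> f x = 0 -> lprod f l = 0.
Proof.
  induction l as [|y l IH]; simpl; [tauto|].
  intros [-> | H] Hx; [rewrite Hx; ring|]. rewrite IH by assumption. ring.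
Qed.

Lemma Rabs_lprod {A : Type} (f : A -> R) (l : list A) :
  Rabs (lprod f l) = lprod (fun x => Rabs (f x)) l.
Proof.
  induction l as [|y l IH]; simpl; [apply Rabs_R1|]. now rewrite Rabs_mult, IH.
Qed.

(** The polynomial with roots [xs] vanishes at every frequency except possibly that of [x0], so the
    functional of the previous lemma reduces to the single term of [x0]. *)
Lemma coef_bound {A : Type} (c : A -> C) (lam : A -> R) (T : list A) (r : R)
  (xs : list R) (x0 : A) :
  0 <= r ->
  (forall x, In x T -> 0 <= lam x <= r) ->
  (forall u, Cmod u <= 1 -> Cmod (expsum c lam T u) <= 1) ->
  (forall y, In y xs -> 0 <= y <= r) ->
  NoDup T -> In x0 T ->
  (forall x, In x T -> x <> x0 -> In (lam x) xs) ->
  Cmod (c x0) * lprod (fun y => Rabs (lam x0 - y)) xs <= (INR (length xs) + r) ^ length xs.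
Proof.
  intros Hr Hlam Hf Hxs Hnd Hx0 Hcover.
  pose proof (lagrange_functional_bound c lam T r (length xs) Hr
    (moment_bound c lam T r Hlam Hf) xs 0 Hxs (le_n _)) as H.
  rewrite (lsum_single _ T x0 Hnd Hx0) in H.
  - rewrite Cmod_mult, Cmod_R, pow_O, Rmult_1_l, Rabs_lprod in H. simpl fact in H.
    rewrite INR_1, Rmult_1_l in H. exact H.
  - intros x Hx Hne. rewrite (lprod_eq_0 _ xs (lam x)); [|auto|ring].
    rewrite Rmult_0_r. ring.
Qed.

(** * Products of distances and continued fractions *)

Lemma lprod_app {A : Type} (f : A -> R) (l1 l2 : list A) :
  lprod f (l1 ++ l2) = lprod f l1 * lprod f l2.
Proof. induction l1 as [|x l1 IH]; simpl; [ring|]; rewrite IH; ring. Qed.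

Lemma lprod_map {A B : Type} (h : A -> B) (f : B -> R) (l : list A) :
  lprod f (map h l) = lprod (fun x => f (h x)) l.
Proof. induction l as [|x l IH]; simpl; [reflexivity|]; now rewrite IH. Qed.

Lemma lprod_flat_map {A B : Type} (h : A -> list B) (f : B -> R) (l : list A) :
  lprod f (flat_map h l) = lprod (fun x => lprod f (h x)) l.
Proof.
  induction l as [|x l IH]; simpl; [reflexivity|]. now rewrite lprod_app, IH.
Qed.

Lemma lprod_ext {A : Type} (f g : A -> R) (l : list A) :
  (forall x, In x l -> f x = g x) -> lprod f l = lprod g l.
Proof.
  induction l as [|x l IH]; simpl; intros H; [reflexivity|].
  rewrite IH, H by auto. reflexivity.
Qed.

Lemma lprod_pos {A : Type} (f : A -> R) (l : list A) :
  (forall x, In x l -> 0 < f x) -> 0 < lprod f l.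
Proof.
  induction l as [|x l IH]; simpl; intros H; [lra|].
  apply Rmult_lt_0_compat; auto.
Qed.

Lemma lprod_le {A : Type} (f g : A -> R) (l : list A) :
  (forall x, In x l -> 0 <= f x <= g x) -> 0 <= lprod f l <= lprod g l.
Proof.
  induction l as [|x l IH]; simpl; intros H; [lra|].
  destruct IH as [I1 I2]; [auto|]. destruct (H x) as [H1 H2]; [auto|].
  split; [now apply Rmult_le_pos|]. now apply Rmult_le_compat.
Qed.

Lemma lprod_mult {A : Type} (f g : A -> R) (l : list A) :
  lprod (fun x => f x * g x) l = lprod f l * lprod g l.
Proof. induction l as [|x l IH]; simpl; [ring|]; rewrite IH; ring. Qed.

Lemma lprod_perm {A : Type} (f : A -> R) (l1 l2 : list A) :
  Permutation l1 l2 -> lprod f l1 = lprod f l2.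
Proof.
  induction 1; simpl; [reflexivity|congruence|ring|congruence].
Qed.

Lemma lprod_seq_S (f : nat -> R) (a m : nat) :
  lprod f (seq a (S m)) = lprod f (seq a m) * f (a + m)%nat.
Proof. rewrite seq_S, lprod_app. unfold lprod at 2; cbn [fold_right]. ring. Qed.

(* Induction on [m], splitting off the index farthest from [x]. *)
Lemma translates_product (g : R -> R) (d : R) (m : nat) (x : R) :
  0 < d -> (forall y, Rabs y <= g y) ->
  (forall i, (i <= m)%nat -> d <= g (INR i - x)) ->
  d * (INR (fact m) / 2 ^ m) <= lprod (fun i => g (INR i - x)) (seq 0 (S m)).
Proof.
  intros Hd Hg. revert x; induction m as [|m IH]; intros x Hx.
  - simpl. specialize (Hx 0%nat (le_n _)). simpl in Hx. lra.
  - assert (E : d * (INR (fact (S m)) / 2 ^ S m) =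
      INR (S m) / 2 * (d * (INR (fact m) / 2 ^ m))).
    { rewrite INR_fact_S. simpl pow. field. apply pow_nonzero; discrR. }
    rewrite E.
    assert (Hpos : 0 <= d * (INR (fact m) / 2 ^ m)).
    { apply Rmult_le_pos; [lra|]. apply Rdiv_le_0_compat; [apply pos_INR|apply pow_lt; lra]. }
    pose proof (pos_INR (S m)) as HS.
    destruct (Rle_lt_dec x (INR (S m) / 2)) as [Hle|Hlt].
    + rewrite lprod_seq_S, Rmult_comm.
      apply Rmult_le_compat; [exact Hpos|lra| |].
      * apply IH. intros i Hi; apply Hx; lia.
      * eapply Rle_trans; [|apply Hg]. eapply Rle_trans; [|apply Rle_abs].
        change (0 + S m)%nat with (S m). lra.
    + change (seq 0 (S (S m))) with (0%nat :: seq 1 (S m)). rewrite <- seq_shift.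
      cbn [lprod fold_right]. fold (lprod (fun i => g (INR i - x)) (map S (seq 0 (S m)))).
      rewrite lprod_map.
      apply Rmult_le_compat; [lra|exact Hpos| |].
      * eapply Rle_trans; [|apply Hg]. rewrite <- Rabs_Ropp.
        eapply Rle_trans; [|apply Rle_abs]. simpl (INR 0). lra.
      * rewrite (lprod_ext _ (fun i => g (INR i - (x - 1)))).
        -- apply IH. intros i Hi. specialize (Hx (S i) ltac:(lia)).
           rewrite S_INR in Hx. replace (INR i - (x - 1)) with (INR i + 1 - x) by ring. exact Hx.
        -- intros i _. rewrite S_INR. f_equal; ring.
Qed.

(** Every factor is at least [a], except at small indices, where it is still at least [b]. These are
    [q] apart, and the first of them is at least [q] because index 0 counts as small in the
    hypothesis; hence there are at most [m / q]. *)
Lemma sparse_product (d : nat -> R) (a b : R) (q m : nat) :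
  0 < a <= 1 -> 0 < b <= 1 ->
  (forall l, (1 <= l <= m)%nat -> b <= d l) ->
  (forall l l', (l < l' <= m)%nat -> (l = 0)%nat \/ d l < a -> d l' < a -> (l + q <= l')%nat) ->
  exists c, (c * q <= m)%nat /\ a ^ m * b ^ c <= lprod d (seq 1 m).
Proof.
  intros Ha Hb Hd Hgap.
  (* [last] is the latest small index met, or the virtual index 0, and [c] counts the small ones. *)
  enough (H : forall k, (k <= m)%nat -> exists c last, (c * q <= last <= k)%nat /\
    ((last = 0)%nat \/ d last < a) /\ a ^ k * b ^ c <= lprod d (seq 1 k)).
  { destruct (H m (le_n _)) as (c & last & H1 & _ & H2). exists c; split; [lia|exact H2]. }
  induction k as [|k IH]; intros Hk.
  - exists 0%nat, 0%nat. split; [lia|]. split; [now left|]. simpl; lra.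
  - destruct IH as (c & last & H1 & H2 & H3); [lia|].
    rewrite lprod_seq_S.
    change (1 + k)%nat with (S k).
    assert (Hpos : 0 < a ^ k * b ^ c) by (apply Rmult_lt_0_compat; apply pow_lt; lra).
    destruct (Rlt_le_dec (d (S k)) a) as [Hlt|Hle].
    + exists (S c), (S k). split; [|split; [now right|]].
      * specialize (Hgap last (S k) ltac:(lia) H2 Hlt). lia.
      (* A small factor is charged [a * b <= b], so that the exponent of [a] need not depend on
         [c]. *)
      * replace (a ^ S k * b ^ S c) with ((a ^ k * b ^ c) * (a * b)) by (simpl; ring).
        pose proof (Hd (S k) ltac:(lia)).
        apply Rmult_le_compat; nra.
    + exists c, last. split; [lia|]. split; [exact H2|].
      replace (a ^ S k * b ^ c) with ((a ^ k * b ^ c) * a) by (simpl; ring).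
      apply Rmult_le_compat; lra.
Qed.

(** * Distance to the nearest integer, and convergents *)

Definition dist_int (y : R) : R :=
  Rmin (y - IZR (Int_part y)) (1 - (y - IZR (Int_part y))).

Lemma dist_int_le (y : R) (p : Z) : dist_int y <= Rabs (y - IZR p).
Proof.
  unfold dist_int. destruct (base_Int_part y) as [H1 H2].
  destruct (Z_le_gt_dec p (Int_part y)) as [Hp|Hp].
  - apply IZR_le in Hp. eapply Rle_trans; [apply Rmin_l|].
    eapply Rle_trans; [|apply Rle_abs]. lra.
  - assert (Hp' : (Int_part y + 1 <= p)%Z) by lia. apply IZR_le in Hp'.
    rewrite plus_IZR in Hp'. eapply Rle_trans; [apply Rmin_r|].
    rewrite Rabs_minus_sym. eapply Rle_trans; [|apply Rle_abs]. lra.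
Qed.

Lemma dist_int_attained (y : R) : exists p : Z, dist_int y = Rabs (y - IZR p).
Proof.
  unfold dist_int. destruct (base_Int_part y) as [H1 H2].
  unfold Rmin; destruct (Rle_dec _ _).
  - exists (Int_part y). rewrite Rabs_pos_eq; lra.
  - exists (Int_part y + 1)%Z. rewrite plus_IZR, Rabs_left1; lra.
Qed.

(** Numerators in the encoding of [cf_qpair]: the previous one travels along, starting from
    [p_(-1) = 1]. So index [s - 1] makes sense at [s = 0], where [thetam] equals -1. *)
Fixpoint cf_ppair (alpha : R) (s : nat) : Z * Z :=
  match s with
  | O => (1%Z, cf_a alpha 0)
  | S s' => let (pm, p) := cf_ppair alpha s' in (p, (cf_a alpha (S s') * p + pm)%Z)
  end.
Definition cf_p (alpha : R) (s : nat) : Z := snd (cf_ppair alpha s).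
Definition cf_pm (alpha : R) (s : nat) : Z := fst (cf_ppair alpha s).
Definition cf_qm (alpha : R) (s : nat) : Z := fst (cf_qpair alpha s).
Definition theta (alpha : R) (s : nat) : R :=
  IZR (cf_q alpha s) * alpha - IZR (cf_p alpha s).
Definition thetam (alpha : R) (s : nat) : R :=
  IZR (cf_qm alpha s) * alpha - IZR (cf_pm alpha s).

Lemma cf_q_S (alpha : R) (s : nat) :
  cf_q alpha (S s) = (cf_a alpha (S s) * cf_q alpha s + cf_qm alpha s)%Z.
Proof. unfold cf_q, cf_qm; simpl. now destruct (cf_qpair alpha s). Qed.

Lemma cf_qm_S (alpha : R) (s : nat) : cf_qm alpha (S s) = cf_q alpha s.
Proof. unfold cf_q, cf_qm; simpl. now destruct (cf_qpair alpha s). Qed.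

Lemma cf_p_S (alpha : R) (s : nat) :
  cf_p alpha (S s) = (cf_a alpha (S s) * cf_p alpha s + cf_pm alpha s)%Z.
Proof. unfold cf_p, cf_pm; simpl. now destruct (cf_ppair alpha s). Qed.

Lemma cf_pm_S (alpha : R) (s : nat) : cf_pm alpha (S s) = cf_p alpha s.
Proof. unfold cf_p, cf_pm; simpl. now destruct (cf_ppair alpha s). Qed.

Definition irrational (alpha : R) : Prop :=
  forall p q : Z, (q <> 0)%Z -> alpha <> IZR p / IZR q.

Lemma irrational_neq (alpha : R) (p q : Z) :
  irrational alpha -> (q <> 0)%Z -> IZR q * alpha - IZR p <> 0.
Proof.
  intros Hirr Hq H. apply (Hirr p q Hq).
  assert (IZR q <> 0) by (now apply not_0_IZR).
  apply Rmult_eq_reg_l with (IZR q); [|assumption]. field_simplify; lra.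
Qed.

Lemma theta_S (alpha : R) (s : nat) :
  theta alpha (S s) = IZR (cf_a alpha (S s)) * theta alpha s + thetam alpha s.
Proof.
  unfold theta, thetam. rewrite cf_q_S, cf_p_S, !plus_IZR, !mult_IZR. ring.
Qed.

(** The central relation is [theta_(s-1) = - x_(s+1) theta_s], with [x] the complete quotients. The
    recurrence turns it into [theta_(s+1) = (a_(s+1) - x_(s+1)) theta_s], whose factor is minus the
    inverse of the next quotient. The determinant is recorded only up to sign, which suffices
    below. *)
Lemma cf_invariant (alpha : R) (s : nat) :
  irrational alpha ->
  1 < cf_x alpha (S s) /\
  thetam alpha s = - cf_x alpha (S s) * theta alpha s /\
  (1 <= cf_q alpha s)%Z /\ (0 <= cf_qm alpha s <= cf_q alpha s)%Z /\
  (Z.abs (cf_q alpha s * cf_pm alpha s - cf_qm alpha s * cf_p alpha s) = 1)%Z.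
Proof.
  intros Hirr.
  assert (HX : forall k, cf_x alpha k <> IZR (cf_a alpha k) -> 1 < cf_x alpha (S k)).
  { intros k Hk. unfold cf_a in Hk. simpl. destruct (base_Int_part (cf_x alpha k)) as [H1 H2].
    rewrite <- Rinv_1. apply Rinv_lt_contravar; lra. }
  induction s as [|s (H1 & H2 & H3 & H4 & H5)].
  - assert (Hne : alpha <> IZR (cf_a alpha 0)).
    { pose proof (irrational_neq alpha (cf_a alpha 0) 1 Hirr ltac:(lia)). lra. }
    split; [now apply HX|]. split; [|unfold cf_q, cf_qm, cf_pm, cf_p; simpl; lia].
    unfold thetam, theta, cf_qm, cf_q, cf_pm, cf_p. simpl.
    change (Int_part alpha) with (cf_a alpha 0). field. lra.
  - assert (Ha : (1 <= cf_a alpha (S s))%Z).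
    { unfold cf_a. destruct (base_Int_part (cf_x alpha (S s))) as [B1 B2].
      apply Z.le_succ_l with (n := 0%Z). apply lt_IZR. lra. }
    assert (Hq : (1 <= cf_q alpha (S s))%Z) by (rewrite cf_q_S; nia).
    assert (Hth : theta alpha (S s) = (IZR (cf_a alpha (S s)) - cf_x alpha (S s)) * theta alpha s)
      by (rewrite theta_S, H2; ring).
    (* An integral complete quotient would make [theta_(s+1)] vanish, so [alpha] would be
       rational. *)
    assert (Hne : cf_x alpha (S s) <> IZR (cf_a alpha (S s))).
    { intros E. apply (irrational_neq alpha (cf_p alpha (S s)) (cf_q alpha (S s)) Hirr); [lia|].
      fold (theta alpha (S s)). rewrite Hth, E. ring. }
    split; [now apply HX|]. split; [|split; [exact Hq|split]].
    + replace (thetam alpha (S s)) with (theta alpha s)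
        by (unfold theta, thetam; now rewrite cf_qm_S, cf_pm_S).
      rewrite Hth. change (cf_x alpha (S (S s))) with
        (/ (cf_x alpha (S s) - IZR (cf_a alpha (S s)))). field. lra.
    + rewrite cf_qm_S, cf_q_S. nia.
    + rewrite cf_q_S, cf_p_S, cf_qm_S, cf_pm_S.
      rewrite <- H5, <- Z.abs_opp. f_equal. ring.
Qed.

Lemma cf_q_pos (alpha : R) (s : nat) : irrational alpha -> (1 <= cf_q alpha s)%Z.
Proof. intros H; apply (cf_invariant alpha s H). Qed.

Lemma Rabs_thetam (alpha : R) (s : nat) : irrational alpha ->
  / (2 * IZR (cf_q alpha s)) <= Rabs (thetam alpha s) <= / IZR (cf_q alpha s).
Proof.
  intros Hirr. destruct (cf_invariant alpha s Hirr) as (H1 & H2 & H3 & [H4 H4'] & H5).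
  set (x := cf_x alpha (S s)) in *. set (t := theta alpha s) in *.
  apply IZR_le in H3, H4, H4'.
  set (q := IZR (cf_q alpha s)) in *. set (qm := IZR (cf_qm alpha s)) in *.
  (* The determinant relation with [theta_(s-1)] eliminated. Hence [|theta_(s-1)| = x / (q x + qm)],
     and both bounds follow from [0 <= qm <= q x]. *)
  assert (E : (q * x + qm) * Rabs t = 1).
  { apply (f_equal IZR) in H5. rewrite abs_IZR, minus_IZR, !mult_IZR in H5.
    rewrite <- H5. rewrite <- (Rabs_pos_eq (q * x + qm)) by nra.
    rewrite <- Rabs_mult. f_equal.
    transitivity (- (q * thetam alpha s - qm * t)).
    - rewrite H2. ring.
    - unfold t, theta, thetam. fold q qm. ring. }
  rewrite H2, Rabs_mult, Rabs_Ropp, (Rabs_pos_eq x) by lra.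
  pose proof (Rabs_pos t) as Ht.
  assert (qm <= q * x) by nra.
  assert (qm * Rabs t <= (q * x) * Rabs t) by (apply Rmult_le_compat_r; lra).
  assert (0 <= qm * Rabs t) by (apply Rmult_le_pos; lra).
  split.
  - apply Rmult_le_reg_l with (2 * q); [lra|]. rewrite Rinv_r by lra. nra.
  - apply Rmult_le_reg_l with q; [lra|]. rewrite Rinv_r by lra. nra.
Qed.

(** In the unimodular basis of two consecutive convergents,
    [l alpha - p = X theta_s + Y theta_(s-1)]. The range of [l] forces [Y] nonzero and [X], [Y] of
    opposite signs, while the two thetas also have opposite signs: nothing cancels, and
    [|theta_(s-1)|] remains. *)
Lemma best_approximation (alpha : R) (s : nat) (l p : Z) : irrational alpha ->
  (0 < l < cf_q alpha s)%Z ->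
  / (2 * IZR (cf_q alpha s)) <= Rabs (IZR l * alpha - IZR p).
Proof.
  intros Hirr Hl. eapply Rle_trans; [apply Rabs_thetam, Hirr|].
  destruct (cf_invariant alpha s Hirr) as (H1 & H2 & H3 & H4 & H5).
  set (q := cf_q alpha s) in *. set (qm := cf_qm alpha s) in *.
  set (P := cf_p alpha s) in *. set (Pm := cf_pm alpha s) in *.
  set (D := (q * Pm - qm * P)%Z) in *.
  assert (HD : (D * D = 1)%Z) by (rewrite <- Z.abs_square, H5; reflexivity).
  (* Cramer's rule; [D] is 1 or -1, hence its own inverse. *)
  set (X := (D * (l * Pm - p * qm))%Z). set (Y := (D * (q * p - P * l))%Z).
  assert (El : (l = X * q + Y * qm)%Z).
  { transitivity (l * (D * D))%Z; [rewrite HD; ring|]. unfold X, Y; replace (D * D)%Z with (D * (q * Pm - qm * P))%Z by reflexivity; ring. }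
  assert (Ep : (p = X * P + Y * Pm)%Z).
  { transitivity (p * (D * D))%Z; [rewrite HD; ring|]. unfold X, Y; replace (D * D)%Z with (D * (q * Pm - qm * P))%Z by reflexivity; ring. }
  clearbody X Y.
  assert (E : IZR l * alpha - IZR p = (IZR X - cf_x alpha (S s) * IZR Y) * theta alpha s).
  { transitivity (IZR X * theta alpha s + IZR Y * thetam alpha s); [|rewrite H2; ring].
    unfold theta, thetam. fold q qm P Pm. rewrite El, Ep, !plus_IZR, !mult_IZR. ring. }
  rewrite E, H2, !Rabs_mult, Rabs_Ropp.
  apply Rmult_le_compat_r; [apply Rabs_pos|].
  set (x := cf_x alpha (S s)) in *. rewrite (Rabs_pos_eq x) by lra.
  assert (C : (0 <= X /\ Y <= -1)%Z \/ (X <= 0 /\ 1 <= Y)%Z).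
  { destruct (Z_le_gt_dec 0 X) as [HX|HX].
    - destruct (Z_le_gt_dec Y (-1)) as [HY|HY]; [left; lia|].
      destruct (Z.eq_dec X 0); [|exfalso; nia].
      right. split; [lia|]. destruct (Z.eq_dec Y 0); [exfalso; nia|lia].
    - right. split; [lia|]. nia. }
  destruct C as [[HX HY]|[HX HY]]; apply IZR_le in HX, HY.
  - eapply Rle_trans; [|apply Rle_abs]. nra.
  - rewrite <- Rabs_Ropp. eapply Rle_trans; [|apply Rle_abs]. nra.
Qed.

(** * The triangle of exponents *)

Lemma dist_int_mul_ge (alpha : R) (s l : nat) : irrational alpha ->
  (0 < Z.of_nat l < cf_q alpha s)%Z ->
  / (2 * IZR (cf_q alpha s)) <= dist_int (INR l * alpha).
Proof.
  intros Hirr Hl. destruct (dist_int_attained (INR l * alpha)) as (p & ->).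
  rewrite INR_IZR_INZ. now apply best_approximation.
Qed.

(* Indices [l] with [l * alpha] within [1/(4 q_s)] of an integer are [q_s]-separated,
   since a difference of two of them would approximate better than [1/(2 q_s)]. *)
Lemma gap_product (alpha : R) (s m : nat) : irrational alpha ->
  (Z.of_nat m < cf_q alpha (S s))%Z ->
  exists c, (Z.of_nat c * cf_q alpha s <= Z.of_nat m)%Z /\
    (/ (4 * IZR (cf_q alpha s))) ^ m * (/ (2 * IZR (cf_q alpha (S s)))) ^ c <=
    lprod (fun l => dist_int (INR l * alpha)) (seq 1 m).
Proof.
  intros Hirr Hm.
  pose proof (cf_q_pos alpha s Hirr) as Hq. pose proof (cf_q_pos alpha (S s) Hirr) as HQ.
  pose proof (IZR_le _ _ Hq) as Hq'. pose proof (IZR_le _ _ HQ) as HQ'.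
  assert (Hinv : forall y, 1 <= y -> 0 < / y <= 1).
  { intros y Hy. split; [apply Rinv_0_lt_compat; lra|].
    rewrite <- Rinv_1. apply Rinv_le_contravar; lra. }
  destruct (sparse_product (fun l => dist_int (INR l * alpha))
    (/ (4 * IZR (cf_q alpha s))) (/ (2 * IZR (cf_q alpha (S s))))
    (Z.to_nat (cf_q alpha s)) m) as (c & Hc & H).
  - apply Hinv; lra.
  - apply Hinv; lra.
  - intros l Hl. apply dist_int_mul_ge; [exact Hirr|lia].
  - intros l l' Hl Hsmall Hsmall'.
    destruct (le_lt_dec (l + Z.to_nat (cf_q alpha s)) l') as [|Hlt]; [assumption|exfalso].
    assert (Hp : exists p, Rabs (INR l * alpha - IZR p) < / (4 * IZR (cf_q alpha s))).
    { destruct Hsmall as [-> | Hs].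
      - exists 0%Z. replace (INR 0 * alpha - 0) with 0 by (simpl; ring). rewrite Rabs_R0.
        apply Hinv; lra.
      - destruct (dist_int_attained (INR l * alpha)) as (p & Hp). exists p. now rewrite <- Hp. }
    destruct Hp as (p & Hp).
    destruct (dist_int_attained (INR l' * alpha)) as (p' & Hp'). rewrite Hp' in Hsmall'.
    pose proof (best_approximation alpha s (Z.of_nat l' - Z.of_nat l) (p' - p) Hirr ltac:(lia)) as Hb.
    rewrite !minus_IZR, <- !INR_IZR_INZ in Hb.
    assert (E : / (2 * IZR (cf_q alpha s)) = / (4 * IZR (cf_q alpha s)) + / (4 * IZR (cf_q alpha s)))
      by (field; lra).
    apply Rabs_def2 in Hp, Hsmall'.
    assert (Rabs ((INR l' - INR l) * alpha - (IZR p' - IZR p)) < / (2 * IZR (cf_q alpha s)))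
      by (apply Rabs_def1; lra).
    lra.
  - exists c. split; [lia|exact H].
Qed.

(** The outer index is the exponent of [w], opposite to [poly_eval]: the frequencies of a row are
    then consecutive translates of [j alpha] by integers, as [translates_product] requires. *)
Definition triangle (n : nat) : list (nat * nat) :=
  flat_map (fun j => map (fun i => (i, j)) (seq 0 (S (n - j)))) (seq 0 (S n)).

Lemma in_triangle (n i j : nat) : In (i, j) (triangle n) <-> (i + j <= n)%nat.
Proof.
  unfold triangle. rewrite in_flat_map. split.
  - intros (j' & Hj & Hi). apply in_map_iff in Hi. destruct Hi as (i' & E & Hi).
    injection E as <- <-. apply in_seq in Hi, Hj. lia.
  - intros H. exists j. rewrite in_seq. split; [lia|].
    apply in_map_iff. exists i. rewrite in_seq. split; [reflexivity|lia].
Qed.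

Lemma NoDup_triangle (n : nat) : NoDup (triangle n).
Proof.
  unfold triangle. pose proof (seq_NoDup (S n) 0) as H. revert H.
  generalize (seq 0 (S n)). induction l as [|j l IH]; intros H; cbn [flat_map]; [constructor|].
  inversion H; subst. apply NoDup_app.
  - apply FinFun.Injective_map_NoDup; [|apply seq_NoDup]. intros a b E. now injection E.
  - now apply IH.
  - intros [a b] Hab Hab'. apply in_map_iff in Hab. destruct Hab as (i & E & _).
    injection E as <- <-. apply in_flat_map in Hab'. destruct Hab' as (j' & Hj' & Hi).
    apply in_map_iff in Hi. destruct Hi as (i' & E & _). injection E as _ <-. contradiction.
Qed.

Lemma length_triangle (n : nat) : (2 * length (triangle n) = (n + 1) * (n + 2))%nat.
Proof.
  unfold triangle.
  enough (H : forall k, (k <= S n)%nat -> (2 * length (flat_map (fun j =>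
    map (fun i => (i, j)) (seq 0 (S (n - j)))) (seq 0 k)) = k * (2 * n + 3 - k))%nat).
  { rewrite H by lia. lia. }
  induction k as [|k IH]; intros Hk; [reflexivity|].
  rewrite seq_S, flat_map_app, length_app, Nat.mul_add_distr_l, IH by lia.
  cbn [flat_map]. rewrite app_nil_r, length_map, length_seq. simpl (0 + k)%nat. nia.
Qed.

Lemma lsum_flat_map {A B : Type} (h : A -> list B) (f : B -> C) (l : list A) :
  lsum f (flat_map h l) = lsum (fun x => lsum f (h x)) l.
Proof.
  induction l as [|x l IH]; simpl; [reflexivity|]. now rewrite lsum_app, IH.
Qed.

Lemma poly_eval_triangle (n : nat) (c : nat -> nat -> C) (z w : C) :
  poly_eval n c z w =
  lsum (fun x => c (fst x) (snd x) * (z ^ fst x * w ^ snd x))%C (triangle n).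
Proof.
  unfold poly_eval. rewrite Csum_lsum.
  set (f := fun x : nat * nat => (c (fst x) (snd x) * (z ^ fst x * w ^ snd x))%C).
  (* Swapping the coordinates gives the order of summation of [poly_eval]; the triangle is
     symmetric, so this is a permutation of it. *)
  transitivity (lsum f (map (fun x => (snd x, fst x)) (triangle n))).
  - unfold triangle. rewrite lsum_map, lsum_flat_map. apply lsum_ext; intros i _.
    rewrite Csum_lsum, lsum_map. reflexivity.
  - apply lsum_perm, NoDup_Permutation.
    + apply FinFun.Injective_map_NoDup; [|apply NoDup_triangle].
      intros [a b] [a' b'] E. simpl in E. congruence.
    + apply NoDup_triangle.
    + intros [i j]. rewrite in_map_iff, in_triangle. split.
      * intros ([a b] & E & H). simpl in E. injection E as <- <-. apply in_triangle in H. lia.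
      * intros H. exists (j, i). split; [reflexivity|]. apply in_triangle. lia.
Qed.

Definition freq (alpha : R) (x : nat * nat) : R := INR (fst x) + INR (snd x) * alpha.

Lemma freq_bounds (alpha : R) (n : nat) (x : nat * nat) : 0 < alpha < 1 ->
  In x (triangle n) -> 0 <= freq alpha x <= INR n.
Proof.
  intros Ha Hx. destruct x as [i j]. apply in_triangle in Hx. unfold freq; cbn [fst snd].
  pose proof (pos_INR i). pose proof (pos_INR j). apply le_INR in Hx. rewrite plus_INR in Hx.
  nra.
Qed.

Lemma freq_diff_eq_0 (alpha : R) (a b : Z) : irrational alpha ->
  IZR a + IZR b * alpha = 0 -> a = 0%Z /\ b = 0%Z.
Proof.
  intros Hirr H. destruct (Z.eq_dec b 0) as [->|Hb].
  - rewrite Rmult_0_l, Rplus_0_r in H. apply eq_IZR in H. now split.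
  - exfalso. apply (irrational_neq alpha (- a) b Hirr Hb). rewrite opp_IZR. lra.
Qed.

Lemma freq_inj (alpha : R) (x y : nat * nat) : irrational alpha ->
  freq alpha x = freq alpha y -> x = y.
Proof.
  intros Hirr H. destruct x as [i j], y as [i' j']. unfold freq in H; cbn [fst snd] in H.
  destruct (freq_diff_eq_0 alpha (Z.of_nat i - Z.of_nat i') (Z.of_nat j - Z.of_nat j') Hirr).
  - rewrite !minus_IZR, <- !INR_IZR_INZ. lra.
  - f_equal; lia.
Qed.

(** Neutralises the zero factor of the node [x0] itself, so that products run over the full triangle
    and keep their row structure. *)
Definition abs_or_1 (y : R) : R := if Req_dec_T y 0 then 1 else Rabs y.

Lemma Rabs_le_abs_or_1 (y : R) : Rabs y <= abs_or_1 y.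
Proof.
  unfold abs_or_1. destruct (Req_dec_T y 0) as [->|]; [rewrite Rabs_R0|]; lra.
Qed.

Lemma lprod_reflect (f : nat -> R) (k : nat) :
  lprod (fun j => f (k - j)%nat) (seq 0 k) = lprod f (seq 1 k).
Proof.
  induction k as [|k IH]; [reflexivity|].
  change (seq 0 (S k)) with (0%nat :: seq 1 k). rewrite <- seq_shift.
  rewrite lprod_seq_S, <- IH.
  change (0%nat :: map S (seq 0 k)) with ([0%nat] ++ map S (seq 0 k)).
  rewrite lprod_app, lprod_map. simpl. ring.
Qed.

(** Lower bound for the factors in a row at distance [l] from that of [x0]. For [l = 0] the
    differences are integers, of modulus at least 1 away from [x0], whose own factor is set to 1. *)
Definition gap (alpha : R) (l : nat) : R :=
  if Nat.eq_dec l 0 then 1 else dist_int (INR l * alpha).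

Lemma gap_pos (alpha : R) (l : nat) : irrational alpha -> 0 < gap alpha l.
Proof.
  intros Hirr. unfold gap. destruct (Nat.eq_dec l 0); [lra|].
  destruct (dist_int_attained (INR l * alpha)) as (p & ->).
  apply Rabs_pos_lt. rewrite INR_IZR_INZ. apply irrational_neq; [exact Hirr|lia].
Qed.

Definition row_factor (m : nat) : R := INR (fact m) / 2 ^ m.

Lemma row_factor_pos (m : nat) : 0 < row_factor m.
Proof. apply Rdiv_lt_0_compat; [apply INR_fact_pos|apply pow_lt; lra]. Qed.

(** With truncated subtraction, [j - j0 + (j0 - j)] is [|j - j0|]; the product splits into the rows
    on either side of [j0]. *)
Lemma lprod_gap (alpha : R) (n j0 : nat) : (j0 <= n)%nat ->
  lprod (fun j => gap alpha (j - j0 + (j0 - j))) (seq 0 (S n)) =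
  lprod (fun l => dist_int (INR l * alpha)) (seq 1 j0) *
  lprod (fun l => dist_int (INR l * alpha)) (seq 1 (n - j0)).
Proof.
  intros Hj.
  assert (G : forall k, lprod (gap alpha) (seq 1 k) =
    lprod (fun l => dist_int (INR l * alpha)) (seq 1 k)).
  { intros k. apply lprod_ext. intros l Hl. apply in_seq in Hl. unfold gap.
    destruct (Nat.eq_dec l 0); [lia|reflexivity]. }
  rewrite <- !G.
  replace (S n) with (j0 + S (n - j0))%nat by lia.
  rewrite seq_app, lprod_app. f_equal.
  - rewrite <- lprod_reflect. apply lprod_ext; intros j H. apply in_seq in H. f_equal. lia.
  - transitivity (lprod (gap alpha) (seq 0 (S (n - j0)))).
    + assert (E : forall k a, lprod (fun j => gap alpha (j - j0 + (j0 - j))) (seq (a + j0) k) =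
        lprod (gap alpha) (seq a k)).
      { induction k as [|k IH]; intros a; [reflexivity|].
        rewrite !lprod_seq_S, IH. f_equal. f_equal. lia. }
      apply E.
    + change (seq 0 (S (n - j0))) with ([0%nat] ++ seq 1 (n - j0)).
      rewrite lprod_app. unfold gap at 1. simpl. ring.
Qed.

(** Row [j] has [n - j + 1] nodes and contributes its gap times [(n - j)! / 2^(n - j)]. The gaps on
    the two sides of [j0] are estimated separately; their numbers [j0] and [n - j0] of rows add up
    to [n], so the exceptional rows still number at most [n / q_s]. *)
Lemma node_product (alpha : R) (s n : nat) (x0 : nat * nat) : irrational alpha ->
  (Z.of_nat n < cf_q alpha (S s))%Z -> In x0 (triangle n) ->
  exists c, (Z.of_nat c * cf_q alpha s <= Z.of_nat n)%Z /\
    lprod row_factor (seq 1 n) *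
      ((/ (4 * IZR (cf_q alpha s))) ^ n * (/ (2 * IZR (cf_q alpha (S s)))) ^ c) <=
    lprod (fun x => abs_or_1 (freq alpha x - freq alpha x0)) (triangle n).
Proof.
  intros Hirr Hn Hx0. destruct x0 as [i0 j0]. apply in_triangle in Hx0.
  destruct (gap_product alpha s j0 Hirr) as (c1 & Hc1 & H1); [lia|].
  destruct (gap_product alpha s (n - j0) Hirr) as (c2 & Hc2 & H2); [lia|].
  exists (c1 + c2)%nat. split; [lia|].
  apply Rle_trans with (lprod (fun j => gap alpha (j - j0 + (j0 - j)) * row_factor (n - j)) (seq 0 (S n))).
  - rewrite lprod_mult, lprod_gap by lia.
    assert (E : lprod (fun j => row_factor (n - j)) (seq 0 (S n)) = lprod row_factor (seq 1 n)).
    { rewrite lprod_seq_S, lprod_reflect. simpl (0 + n)%nat. rewrite Nat.sub_diag.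
      unfold row_factor at 2. simpl. field. }
    rewrite E, Rmult_comm. apply Rmult_le_compat_r.
    + left; apply lprod_pos; intros; apply row_factor_pos.
    + rewrite pow_add.
      assert (En : (/ (4 * IZR (cf_q alpha s))) ^ n =
        (/ (4 * IZR (cf_q alpha s))) ^ j0 * (/ (4 * IZR (cf_q alpha s))) ^ (n - j0)).
      { rewrite <- pow_add. f_equal. lia. }
      rewrite En. pose proof (cf_q_pos alpha s Hirr) as Hq. pose proof (cf_q_pos alpha (S s) Hirr) as HQ.
      apply IZR_le in Hq, HQ.
      assert (P1 : forall k, 0 <= (/ (4 * IZR (cf_q alpha s))) ^ k)
        by (intros; apply pow_le; left; apply Rinv_0_lt_compat; lra).
      assert (P2 : forall k, 0 <= (/ (2 * IZR (cf_q alpha (S s)))) ^ k)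
        by (intros; apply pow_le; left; apply Rinv_0_lt_compat; lra).
      match goal with |- ?a * ?b * (?c * ?d) <= _ =>
        replace (a * b * (c * d)) with ((a * c) * (b * d)) by ring end.
      apply Rmult_le_compat; try assumption; apply Rmult_le_pos; auto.
  - unfold triangle. rewrite lprod_flat_map. apply lprod_le; intros j Hj. apply in_seq in Hj.
    pose proof (gap_pos alpha (j - j0 + (j0 - j)) Hirr) as Hg.
    split; [apply Rmult_le_pos; [lra|left; apply row_factor_pos]|].
    rewrite lprod_map.
    rewrite (lprod_ext _ (fun i => abs_or_1 (INR i - (INR i0 + INR j0 * alpha - INR j * alpha)))).
    2:{ intros i _. unfold freq; cbn [fst snd]. f_equal; ring. }
    apply translates_product; [exact Hg|apply Rabs_le_abs_or_1|].
    intros i Hi.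
    assert (Ey : INR i - (INR i0 + INR j0 * alpha - INR j * alpha) =
      IZR (Z.of_nat i - Z.of_nat i0) + IZR (Z.of_nat j - Z.of_nat j0) * alpha).
    { rewrite !minus_IZR, <- !INR_IZR_INZ. ring. }
    rewrite Ey. unfold abs_or_1, gap.
    (* By irrationality the difference vanishes only at [x0], which lies in the row of gap 1. *)
    destruct (Req_dec_T _ 0) as [E0|E0].
    + apply freq_diff_eq_0 in E0; [|exact Hirr].
      destruct (Nat.eq_dec _ 0); [lra|lia].
    + destruct (Nat.eq_dec _ 0) as [Ej|Ej].
      * replace (Z.of_nat j - Z.of_nat j0)%Z with 0%Z in * by lia.
        rewrite Rmult_0_l, Rplus_0_r in *. rewrite <- abs_IZR. apply IZR_le.
        destruct (Z.eq_dec (Z.of_nat i - Z.of_nat i0) 0) as [E|E]; [|lia].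
        exfalso; apply E0; now rewrite E.
      * destruct (le_lt_dec j j0) as [Hjj|Hjj].
        -- eapply Rle_trans; [apply (dist_int_le _ (Z.of_nat i - Z.of_nat i0))|].
           rewrite <- Rabs_Ropp. right; f_equal.
           replace (j - j0 + (j0 - j))%nat with (j0 - j)%nat by lia.
           rewrite minus_INR by lia. rewrite !minus_IZR, <- !INR_IZR_INZ. ring.
        -- eapply Rle_trans; [apply (dist_int_le _ (Z.of_nat i0 - Z.of_nat i))|].
           right; f_equal.
           replace (j - j0 + (j0 - j))%nat with (j - j0)%nat by lia.
           rewrite minus_INR by lia. rewrite !minus_IZR, <- !INR_IZR_INZ. ring.
Qed.

(** * The upper bound *)

Definition coefs (c : nat -> nat -> C) (x : nat * nat) : C := c (fst x) (snd x).

Lemma poly_eval_curve (alpha : R) (n : nat) (c : nat -> nat -> C) (u : C) :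
  poly_eval n c (Cexp u) (Cexp (Cscal alpha u)) =
  expsum (coefs c) (freq alpha) (triangle n) u.
Proof.
  rewrite poly_eval_triangle. apply lsum_ext; intros [i j] _. unfold coefs; cbn [fst snd].
  f_equal.
  change (cexp u ^ i * cexp (Cscal alpha u) ^ j = cexp (freq alpha (i, j) * u))%C.
  rewrite !cexp_pow, <- cexp_add. f_equal.
  unfold Cscal, freq, Cmult, Cplus, RtoC; cbn [fst snd]. f_equal; ring.
Qed.

Lemma normK_le1_iff (alpha : R) (n : nat) (c : nat -> nat -> C) :
  normK_le1 alpha n c <->
  forall u, Cmod u <= 1 -> Cmod (expsum (coefs c) (freq alpha) (triangle n) u) <= 1.
Proof.
  unfold normK_le1, in_K. split.
  - intros H u Hu. rewrite <- poly_eval_curve. apply H. exists u. now split.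
  - intros H z w (u & Hu & -> & ->). rewrite poly_eval_curve. now apply H.
Qed.

Lemma ln_le_sub_1 (x : R) : 0 < x -> ln x <= x - 1.
Proof.
  intros Hx. pose proof (exp_ineq1_le (ln x)) as H. rewrite exp_ln in H by exact Hx. lra.
Qed.

(** Concavity: the tangent at [a] lies above the logarithm. The numerical estimates below differ
    mainly in the choice of [a]. *)
Lemma ln_le_lin (x a : R) : 0 < x -> 0 < a -> ln x <= ln a + x / a - 1.
Proof.
  intros Hx Ha. pose proof (ln_le_sub_1 (x / a) (Rdiv_lt_0_compat _ _ Hx Ha)) as H.
  rewrite ln_div in H by assumption. lra.
Qed.

Lemma ln_2_le : ln 2 <= 7 / 10.
Proof.
  rewrite <- (ln_exp (7 / 10)). apply ln_le; [lra|].
  eapply Rle_trans; [|apply (exp_ge_taylor (7 / 10) 3); lra].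
  simpl. lra.
Qed.

Lemma ln_fact_ge (m : nat) : INR m * ln (INR m) - INR m <= ln (INR (fact m)).
Proof.
  induction m as [|m IH]; [simpl; rewrite ln_1; lra|].
  rewrite INR_fact_S.
  assert (HS : 0 < INR (S m)) by (apply lt_0_INR; lia).
  rewrite ln_mult by (try apply INR_fact_pos; assumption).
  enough (INR m * (ln (INR (S m)) - ln (INR m)) <= 1) by (rewrite S_INR in *; nra).
  destruct m as [|m]; [simpl; lra|].
  assert (Hm : 0 < INR (S m)) by (apply lt_0_INR; lia).
  pose proof (ln_le_lin (INR (S (S m))) (INR (S m)) HS Hm) as H.
  rewrite (S_INR (S m)) in H at 2.
  replace ((INR (S m) + 1) / INR (S m)) with (1 + / INR (S m)) in H by (field; lra).
  apply Rle_trans with (INR (S m) * / INR (S m)); [|rewrite Rinv_r; lra].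
  apply Rmult_le_compat_l; lra.
Qed.

(** Summing [m ln m - m] loses [n^2 / 4 + n^2 / 2], whence the [3 / 4]; the term with [ln 2] is the
    product of the powers of 2. The constant [5 / 4] makes both sides equal at [n = 1]. *)
Lemma ln_superfactorial_ge (n : nat) : (1 <= n)%nat ->
  INR n ^ 2 * ln (INR n) / 2 - 3 / 4 * INR n ^ 2 - INR n / 2 + 5 / 4
    - ln 2 * (INR n * (INR n + 1) / 2) <= ln (lprod row_factor (seq 1 n)).
Proof.
  intros Hn. induction Hn as [|n Hn IH].
  - simpl. unfold row_factor. simpl. rewrite ln_1.
    replace (1 / (2 * 1) * 1) with (/ 2) by field. rewrite ln_Rinv by lra. lra.
  - rewrite lprod_seq_S. change (1 + n)%nat with (S n).
    rewrite ln_mult; [|apply lprod_pos; intros; apply row_factor_pos|apply row_factor_pos].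
    unfold row_factor at 2. rewrite ln_div by (try apply INR_fact_pos; apply pow_lt; lra).
    rewrite ln_pow by lra.
    pose proof (ln_fact_ge (S n)) as Hf.
    assert (Hn0 : 1 <= INR n) by (apply (le_INR 1); lia).
    rewrite S_INR in *. set (x := INR n) in *.
    pose proof (ln_le_lin (x + 1) x ltac:(lra) ltac:(lra)) as H.
    assert (H' : x ^ 2 / 2 * (ln (x + 1) - ln x) <= x / 2).
    { replace (x / 2) with (x ^ 2 / 2 * / x) by (field; lra).
      apply Rmult_le_compat_l; [nra|].
      replace ((x + 1) / x) with (1 + / x) in H by (field; lra). lra. }
    assert (Hl : 0 <= ln (x + 1)) by (rewrite <- ln_1; apply ln_le; lra).
    nra.
Qed.

(** [coef_bound] with all other frequencies of the triangle as roots; the factor 1 that [abs_or_1]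
    assigns to [x0] restores the full product. *)
Lemma coef_node_bound (alpha : R) (n : nat) (c : nat -> nat -> C) (x0 : nat * nat) :
  0 < alpha < 1 -> irrational alpha -> normK_le1 alpha n c -> In x0 (triangle n) ->
  Cmod (coefs c x0) *
    lprod (fun x => abs_or_1 (freq alpha x - freq alpha x0)) (triangle n) <=
  (INR (length (triangle n) - 1) + INR n) ^ (length (triangle n) - 1).
Proof.
  intros Ha Hirr Hc Hx0.
  destruct (in_split _ _ Hx0) as (l1 & l2 & El).
  assert (Hnd := NoDup_triangle n). rewrite El in Hnd.
  apply NoDup_remove_2 in Hnd.
  assert (HP : Permutation (triangle n) (x0 :: l1 ++ l2))
    by (rewrite El; symmetry; apply Permutation_middle).
  pose proof (coef_bound (coefs c) (freq alpha) (triangle n) (INR n)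
    (map (freq alpha) (l1 ++ l2)) x0 (pos_INR n)) as H.
  assert (Hlen : length (map (freq alpha) (l1 ++ l2)) = (length (triangle n) - 1)%nat).
  { rewrite length_map, (Permutation_length HP). simpl. lia. }
  rewrite Hlen in H.
  eapply Rle_trans; [|apply H].
  - right. f_equal. rewrite (lprod_perm _ _ _ HP), lprod_map. cbn [lprod fold_right].
    fold (lprod (fun x => abs_or_1 (freq alpha x - freq alpha x0)) (l1 ++ l2)).
    replace (abs_or_1 (freq alpha x0 - freq alpha x0)) with 1.
    + rewrite Rmult_1_l. apply lprod_ext. intros x Hx. unfold abs_or_1.
      destruct (Req_dec_T _ 0) as [E|E]; [|apply Rabs_minus_sym].
      exfalso. apply Rminus_diag_uniq, freq_inj in E; [|exact Hirr]. now subst x.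
    + unfold abs_or_1. destruct (Req_dec_T _ 0); [reflexivity|lra].
  - intros x Hx. now apply freq_bounds.
  - now apply normK_le1_iff.
  - intros y Hy. apply in_map_iff in Hy. destruct Hy as (x & <- & Hx).
    apply freq_bounds; [exact Ha|]. rewrite HP. now right.
  - apply NoDup_triangle.
  - exact Hx0.
  - intros x Hx Hne. apply in_map. rewrite HP in Hx. destruct Hx; [congruence|assumption].
Qed.

Lemma poly_eval_bidisk_le (n : nat) (c : nat -> nat -> C) (z w : C) (B : R) :
  in_bidisk z w -> (forall x, In x (triangle n) -> Cmod (coefs c x) <= B) ->
  Cmod (poly_eval n c z w) <= INR (length (triangle n)) * B.
Proof.
  intros [Hz Hw] HB. rewrite poly_eval_triangle. apply Cmod_lsum_le.
  change (Cmod z <= 1) in Hz. change (Cmod w <= 1) in Hw.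
  intros x Hx. specialize (HB x Hx). fold (coefs c x).
  rewrite !Cmod_mult, !Cmod_pow.
  assert (P : forall y k, 0 <= y <= 1 -> 0 <= y ^ k <= 1).
  { intros y k Hy. split; [apply pow_le; lra|]. rewrite <- (pow1 k). now apply pow_incr. }
  pose proof (P _ (fst x) (conj (Cmod_ge_0 z) Hz)). pose proof (P _ (snd x) (conj (Cmod_ge_0 w) Hw)).
  pose proof (Cmod_ge_0 (coefs c x)).
  assert (0 <= Cmod z ^ fst x * Cmod w ^ snd x <= 1) by nra. nra.
Qed.

Lemma ln_node_product (alpha : R) (s n : nat) (x0 : nat * nat) : irrational alpha ->
  (Z.of_nat n < cf_q alpha (S s))%Z -> In x0 (triangle n) ->
  ln (lprod row_factor (seq 1 n)) - INR n * ln (4 * IZR (cf_q alpha s))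
    - INR n / IZR (cf_q alpha s) * ln (2 * IZR (cf_q alpha (S s))) <=
  ln (lprod (fun x => abs_or_1 (freq alpha x - freq alpha x0)) (triangle n)).
Proof.
  intros Hirr Hn Hx0.
  destruct (node_product alpha s n x0 Hirr Hn Hx0) as (c & Hc & H).
  pose proof (cf_q_pos alpha s Hirr) as Hq. pose proof (cf_q_pos alpha (S s) Hirr) as HQ.
  apply IZR_le in Hq, HQ, Hc. rewrite mult_IZR, <- !INR_IZR_INZ in Hc.
  set (q := IZR (cf_q alpha s)) in *. set (Q := IZR (cf_q alpha (S s))) in *.
  assert (Hrow : 0 < lprod row_factor (seq 1 n)) by (apply lprod_pos; intros; apply row_factor_pos).
  assert (H1 : 0 < (/ (4 * q)) ^ n) by (apply pow_lt, Rinv_0_lt_compat; lra).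
  assert (H2 : 0 < (/ (2 * Q)) ^ c) by (apply pow_lt, Rinv_0_lt_compat; lra).
  apply ln_le in H; [|apply Rmult_lt_0_compat; [exact Hrow|now apply Rmult_lt_0_compat]].
  rewrite !ln_mult in H by (try assumption; try lra; now apply Rmult_lt_0_compat).
  rewrite !ln_pow, !ln_Rinv in H by (try apply Rinv_0_lt_compat; lra).
  assert (HQ2 : 0 <= ln (2 * Q)) by (rewrite <- ln_1; apply ln_le; lra).
  assert (Hcq : INR c <= INR n / q).
  { apply Rmult_le_reg_r with q; [lra|]. unfold Rdiv. rewrite Rmult_assoc, Rinv_l; lra. }
  assert (INR c * ln (2 * Q) <= INR n / q * ln (2 * Q)) by (now apply Rmult_le_compat_r).
  lra.
Qed.

Lemma En_upper (alpha : R) (s n : nat) (t : R) :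
  0 < alpha < 1 -> irrational alpha -> (1 <= n)%nat ->
  (cf_q alpha s <= Z.of_nat n)%Z -> (Z.of_nat n < cf_q alpha (S s))%Z ->
  En_set alpha n t ->
  t <= exp (INR n ^ 2 * ln (INR n) / 2 + 9 * INR n ^ 2
            + INR n / IZR (cf_q alpha s) * ln (IZR (cf_q alpha (S s)))).
Proof.
  intros Ha Hirr Hn Hlo Hhi (c & Hc & z & w & Hzw & ->).
  pose proof (length_triangle n) as HN.
  set (N := length (triangle n)) in *.
  assert (HNpos : (2 <= N)%nat) by nia.
  set (M := (N - 1)%nat).
  set (low := ln (lprod row_factor (seq 1 n)) - INR n * ln (4 * IZR (cf_q alpha s))
    - INR n / IZR (cf_q alpha s) * ln (2 * IZR (cf_q alpha (S s)))).
  assert (Hx1 : 1 <= INR n) by (apply (le_INR 1); lia).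
  assert (HM1 : 1 <= INR M) by (apply (le_INR 1); lia).
  assert (HMn : 0 < INR M + INR n) by lra.
  eapply Rle_trans.
  { apply (poly_eval_bidisk_le n c z w ((INR M + INR n) ^ M / exp low) Hzw).
    intros x0 Hx0. pose proof (coef_node_bound alpha n c x0 Ha Hirr Hc Hx0) as H.
    fold N M in H.
    pose proof (ln_node_product alpha s n x0 Hirr Hhi Hx0) as Hl. fold low in Hl.
    set (L := lprod _ (triangle n)) in *.
    assert (HL : 0 < L).
    { apply lprod_pos. intros x _. unfold abs_or_1. destruct (Req_dec_T _ 0); [lra|].
      now apply Rabs_pos_lt. }
    assert (HeL : exp low <= L) by (rewrite <- (exp_ln L HL); now apply exp_le_compat).
    pose proof (exp_pos low). pose proof (Cmod_ge_0 (coefs c x0)).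
    apply Rmult_le_reg_r with (exp low); [assumption|].
    unfold Rdiv. rewrite Rmult_assoc, Rinv_l, Rmult_1_r by lra.
    eapply Rle_trans; [|exact H]. now apply Rmult_le_compat_l. }
  fold N.
  assert (HN0 : 0 < INR N) by (apply lt_0_INR; lia).
  assert (E : INR N * ((INR M + INR n) ^ M / exp low) =
    exp (ln (INR N) + INR M * ln (INR M + INR n) - low)).
  { unfold Rminus. rewrite !exp_plus, exp_Ropp, exp_ln by assumption.
    rewrite <- ln_pow, exp_ln by (try apply pow_lt; assumption). field.
    apply Rgt_not_eq, exp_pos. }
  rewrite E. apply exp_le_compat.
  pose proof (cf_q_pos alpha s Hirr) as Hq. pose proof (cf_q_pos alpha (S s) Hirr) as HQ.
  apply IZR_le in Hq, HQ, Hlo. rewrite <- INR_IZR_INZ in Hlo.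
  pose proof (ln_superfactorial_ge n Hn) as HW.
  set (x := INR n) in *. set (q := IZR (cf_q alpha s)) in *. set (Q := IZR (cf_q alpha (S s))) in *.
  assert (EN : INR N = (x + 1) * (x + 2) / 2).
  { apply (f_equal INR) in HN. rewrite !mult_INR, !plus_INR in HN. change (INR 2) with (1 + 1) in HN. change (INR 1) with 1 in HN. fold x in HN. lra. }
  assert (EM : INR M = (x ^ 2 + 3 * x) / 2).
  { unfold M. rewrite minus_INR by lia. rewrite EN. change (INR 1) with 1. field. }
  pose proof ln_2_le as L2.
  assert (L2' : 0 <= ln 2) by (rewrite <- ln_1; apply ln_le; lra).
  assert (B1 : ln (INR N) <= (x ^ 2 + 3 * x + 2) / 4 - 3 / 10).
  { pose proof (ln_le_lin (INR N) 2 HN0 ltac:(lra)) as H. rewrite EN in H at 2. lra. }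
  (* Tangent at [x^2], the order of magnitude of [M]. *)
  assert (B2 : INR M * ln (INR M + x) <= (x ^ 2 + 3 * x) * ln x + (15 + 2 * x - x ^ 2) / 4).
  { pose proof (ln_le_lin (INR M + x) (x * x) HMn ltac:(nra)) as H.
    rewrite ln_mult in H by lra. rewrite EM in H at 2.
    replace (((x ^ 2 + 3 * x) / 2 + x) / (x * x)) with ((x + 5) / (2 * x)) in H by (field; lra).
    replace ((x ^ 2 + 3 * x) * ln x + (15 + 2 * x - x ^ 2) / 4)
      with (INR M * (ln x + ln x + (x + 5) / (2 * x) - 1)) by (rewrite EM; field; lra).
    apply Rmult_le_compat_l; lra. }
  (* Here [q_s <= n] enters: ordinary rows cost no more than [x ln x] plus a linear term. *)
  assert (B3 : x * ln (4 * q) <= x * (14 / 10 + ln x)).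
  { apply Rmult_le_compat_l; [lra|]. replace (4 * q) with (2 * 2 * q) by ring.
    rewrite !ln_mult by lra. assert (ln q <= ln x) by (apply ln_le; lra). lra. }
  assert (B4 : x / q * ln (2 * Q) <= x / q * ln Q + 7 / 10 * x).
  { rewrite ln_mult by lra. rewrite Rmult_plus_distr_l.
    assert (0 <= x / q <= x).
    { split; [apply Rdiv_le_0_compat; lra|].
      apply Rmult_le_reg_r with q; [lra|]. unfold Rdiv. rewrite Rmult_assoc, Rinv_l by lra. nra. }
    nra. }
  (* Tangent at 2. It absorbs the surplus [4 x ln x], of which [B2] leaves three parts and [B3]
     one. *)
  assert (B5 : x * ln x <= x ^ 2 / 2 - 3 / 10 * x).
  { pose proof (ln_le_lin x 2 ltac:(lra) ltac:(lra)) as H. nra. }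
  assert (B6 : ln 2 * (x * (x + 1) / 2) <= 7 / 10 * (x * (x + 1) / 2))
    by (apply Rmult_le_compat_r; nra).
  assert (B7 : x <= x ^ 2) by nra.
  (* Beyond the main terms the bounds add up to [3.1 x^2 + 3 x + 2.7], which is below [9 x^2] for
     [x >= 1]. *)
  unfold low. clear - HW B1 B2 B3 B4 B5 B6 B7 Hx1. lra.
Qed.

(** * The lower bounds *)

(* Divided differences: passing from [xs] to [y :: xs] divides the weights by [x - y]. *)
Lemma exists_moment_annihilator (xs : list R) : NoDup xs -> xs <> [] ->
  exists v : R -> R, (exists x, In x xs /\ v x <> 0) /\
    forall k, (S k < length xs)%nat -> lsum (fun x => v x * RtoC (x ^ k))%C xs = RtoC 0.
Proof.
  induction xs as [|y xs IH]; intros Hnd Hne; [congruence|].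
  inversion Hnd as [|? ? Hy Hnd']; subst.
  destruct xs as [|y' xs'].
  { exists (fun _ => 1). split; [exists y; split; [now left|lra]|]. simpl; intros; lia. }
  destruct IH as (v & (x1 & Hx1 & Hv1) & Hv); [assumption|discriminate|].
  set (xs := y' :: xs') in *.
  set (v' := fun x => v x / (x - y)).
  set (v'' := fun x => if Req_dec_T x y then - lsumR v' xs else v' x).
  assert (Hneq : forall x, In x xs -> x <> y) by (intros x Hx ->; contradiction).
  assert (Hv'' : forall x, In x xs -> v'' x = v' x).
  { intros x Hx. unfold v''. destruct (Req_dec_T x y); [|reflexivity].
    now apply Hneq in Hx. }
  exists v''. split.
  { exists x1. split; [now right|]. rewrite Hv'' by assumption. unfold v'.
    apply Rmult_integral_contrapositive_currified; [assumption|].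
    apply Rinv_neq_0_compat. apply Hneq in Hx1. lra. }
  assert (E : forall k, lsum (fun x => v'' x * RtoC (x ^ k))%C (y :: xs) =
    lsum (fun x => v' x * RtoC (x ^ k - y ^ k)%R)%C xs).
  { intros k. cbn [lsum fold_right]. fold (lsum (fun x => v'' x * RtoC (x ^ k))%C xs).
    replace (v'' y) with (- lsumR v' xs) by (unfold v''; destruct (Req_dec_T y y); [reflexivity|congruence]).
    rewrite (lsum_ext _ (fun x => v' x * RtoC (x ^ k))%C) by (intros x Hx; now rewrite Hv'').
    clear. induction xs as [|x xs IH]; simpl; [rewrite RtoC_opp; ring|].
    rewrite <- IH, !RtoC_opp, RtoC_plus, RtoC_minus. ring. }
  intros k Hk. rewrite E. simpl length in Hk. fold (length xs) in Hk.
  induction k as [|k IHk].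
  - apply lsum_zero. intros x _. simpl. rewrite Rminus_diag. ring.
  (* Uses [x^(k+1) - y^(k+1) = x^k (x - y) + y (x^k - y^k)]: the first part gives a moment of the
     old weights, the second the case [k]. *)
  - rewrite (lsum_ext _ (fun x => v x * RtoC (x ^ k) + y * (v' x * RtoC (x ^ k - y ^ k)%R))%C).
    + rewrite lsum_plus, lsum_scal, IHk, Hv by (unfold xs; simpl length in *; lia). ring.
    + intros x Hx. apply Hneq in Hx.
      rewrite <- !RtoC_mult, <- RtoC_plus. f_equal. unfold v'. simpl. field. lra.
Qed.

Lemma poly_eval_nested (n : nat) (c : nat -> nat -> C) (z w : C) :
  poly_eval n c z w =
  lsum (fun i => lsum (fun j => c i j * w ^ j)%C (seq 0 (S (n - i))) * z ^ i)%C (seq 0 (S n)).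
Proof.
  unfold poly_eval. rewrite Csum_lsum. apply lsum_ext; intros i _.
  rewrite Csum_lsum, Cmult_comm, <- lsum_scal. apply lsum_ext; intros j _.
  change (c i j * (z ^ i * w ^ j) = z ^ i * (c i j * w ^ j))%C. ring.
Qed.

(** One variable at a time: [w] is chosen for the polynomial multiplying [z^i], then [z] for the
    polynomial in [z] that this [w] leaves. *)
Lemma coef_le_sup_bidisk (n : nat) (c : nat -> nat -> C) (i j : nat) : (i + j <= n)%nat ->
  exists z w, in_bidisk z w /\ Cmod (c i j) <= Cmod (poly_eval n c z w).
Proof.
  intros Hij.
  destruct (coef_le_sup (S (n - i)) (c i) j) as (w & Hw & H1); [lia|].
  destruct (coef_le_sup (S n) (fun i => lsum (fun j => c i j * w ^ j)%C (seq 0 (S (n - i)))) i)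
    as (z & Hz & H2); [lia|].
  exists z, w. split; [split; apply Req_le; assumption|].
  rewrite poly_eval_nested. eapply Rle_trans; [exact H1|exact H2].
Qed.

Lemma En_set_scaled (alpha : R) (n : nat) (c : nat -> nat -> C) (B : R) (z w : C) :
  0 < B ->
  (forall u, Cmod u <= 1 -> Cmod (expsum (coefs c) (freq alpha) (triangle n) u) <= B) ->
  in_bidisk z w -> En_set alpha n (Cmod (poly_eval n c z w) / B).
Proof.
  intros HB Hc Hzw.
  assert (HB' : 0 < / B) by now apply Rinv_0_lt_compat.
  exists (fun i j => RtoC (/ B) * c i j)%C. split.
  - apply normK_le1_iff. intros u Hu. unfold expsum.
    rewrite (lsum_ext _ (fun x => RtoC (/ B) * (coefs c x * cexp (freq alpha x * u)))%C)
      by (intros x _; unfold coefs; ring).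
    rewrite lsum_scal, Cmod_mult, Cmod_R, Rabs_pos_eq by lra.
    apply Rmult_le_reg_l with B; [assumption|]. rewrite <- Rmult_assoc, Rinv_r, Rmult_1_l, Rmult_1_r by lra.
    now apply Hc.
  - exists z, w. split; [exact Hzw|]. symmetry.
    etransitivity; [apply (f_equal Cmod), poly_eval_triangle|].
    rewrite (lsum_ext _ (fun x => RtoC (/ B) * (c (fst x) (snd x) * (z ^ fst x * w ^ snd x)))%C)
      by (intros x _; ring).
    rewrite lsum_scal, <- poly_eval_triangle, Cmod_mult, Cmod_R, Rabs_pos_eq by lra.
    apply Rmult_comm.
Qed.

Lemma lsumR_pos {A : Type} (f : A -> R) (l : list A) (x : A) :
  (forall y, 0 <= f y) -> In x l -> 0 < f x -> 0 < lsumR f l.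
Proof.
  intros H0 Hin Hx. assert (Hp : forall l, 0 <= lsumR f l).
  { induction l0 as [|y l0 IH]; simpl; [lra|]. specialize (H0 y). lra. }
  induction l as [|y l IH]; simpl in *; [tauto|].
  destruct Hin as [->|Hin]; [specialize (Hp l); lra|]. specialize (IH Hin). specialize (H0 y). lra.
Qed.

Lemma exists_ge_average {A : Type} (f : A -> R) (l : list A) : l <> [] ->
  exists x, In x l /\ lsumR f l / INR (length l) <= f x.
Proof.
  intros Hne.
  assert (Hl : 0 < INR (length l)) by (apply lt_0_INR; destruct l; [congruence|simpl; lia]).
  enough (H : forall s, (forall x, In x l -> f x < s) -> lsumR f l < INR (length l) * s).
  { destruct (List.Exists_dec (fun x => lsumR f l / INR (length l) <= f x) l) as [He|He].
    - intros; apply Rle_dec.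
    - apply Exists_exists in He. exact He.
    - exfalso. specialize (H (lsumR f l / INR (length l))).
      lapply H.
      + intros H'. unfold Rdiv in H'. rewrite <- Rmult_assoc, (Rmult_comm (INR _)), Rmult_assoc, Rinv_r in H' by lra. lra.
      + intros x Hx. apply Rnot_le_lt. intros Hle. apply He, Exists_exists. eauto. }
  clear Hl. induction l as [|x l IH]; intros s Hs; [congruence|].
  pose proof (Hs x (or_introl eq_refl)) as Hx.
  rewrite length_cons, S_INR. simpl.
  destruct l as [|y l]; [simpl; lra|].
  specialize (IH ltac:(discriminate) s ltac:(intros; apply Hs; now right)). lra.
Qed.

(* A nonzero polynomial vanishing to order [N - 1] at the origin of the curve, [N = dim P_n]. *)
Lemma En_lower_dimension (alpha : R) (n : nat) :
  0 < alpha < 1 -> irrational alpha -> (1 <= n)%nat ->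
  let N := length (triangle n) in
  exists t, En_set alpha n t /\
    INR (fact (N - 1)) / (INR N * (INR n ^ (N - 1) * exp (INR n))) <= t.
Proof.
  intros Ha Hirr Hn N.
  pose proof (length_triangle n) as HN. fold N in HN.
  assert (HNpos : (2 <= N)%nat) by nia.
  set (T := triangle n) in *.
  destruct (exists_moment_annihilator (map (freq alpha) T)) as (v & (y & Hy & Hvy) & Hv).
  { apply FinFun.Injective_map_NoDup; [|apply NoDup_triangle].
    intros a b. now apply freq_inj. }
  { intros E. apply map_eq_nil in E. unfold N in HNpos. rewrite E in HNpos. simpl in HNpos. lia. }
  rewrite length_map in Hv. fold N in Hv.
  apply in_map_iff in Hy. destruct Hy as (x1 & <- & Hx1).
  set (c := fun i j => RtoC (v (freq alpha (i, j)))).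
  assert (Hc : forall x, coefs c x = RtoC (v (freq alpha x))) by (intros [i j]; reflexivity).
  set (S := lsumR (fun x => Cmod (coefs c x)) T).
  assert (HS : 0 < S).
  { apply lsumR_pos with x1; [intros; apply Cmod_ge_0|exact Hx1|].
    rewrite Hc, Cmod_R. now apply Rabs_pos_lt. }
  set (eps := INR n ^ (N - 1) / INR (fact (N - 1)) * exp (INR n)).
  assert (Hn0 : 0 < INR n) by (apply lt_0_INR; lia).
  pose proof (INR_fact_pos (N - 1)) as Hf.
  assert (Heps : 0 < eps).
  { apply Rmult_lt_0_compat; [|apply exp_pos]. apply Rdiv_lt_0_compat; [now apply pow_lt|exact Hf]. }
  assert (Hbound : forall u, Cmod u <= 1 -> Cmod (expsum (coefs c) (freq alpha) T u) <= S * eps).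
  { intros u Hu.
    pose proof (expsum_taylor (coefs c) (freq alpha) T (INR n) (N - 1) u) as H.
    fold S eps in H. rewrite texp_moments in H.
    rewrite (lsum_zero (fun k => / INR (fact k) * moment (coefs c) (freq alpha) T k * u ^ k)%C) in H.
    - replace (expsum (coefs c) (freq alpha) T u - 0)%C with (expsum (coefs c) (freq alpha) T u) in H by ring.
      apply H; [|exact Hu]. intros x Hx. now apply freq_bounds.
    - intros k Hk. apply in_seq in Hk.
      assert (E : moment (coefs c) (freq alpha) T k = RtoC 0); [|rewrite E; ring].
      rewrite <- (Hv k) by lia. rewrite lsum_map. apply lsum_ext; intros x _. now rewrite Hc. }
  (* Some coefficient is at least [S / N]; the unknown size [S] cancels against the bound [S * eps]
     on the curve. *)
  destruct (exists_ge_average (fun x => Cmod (coefs c x)) T) as ([i j] & Hij & Havg).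
  { intros E. rewrite E in Hx1. destruct Hx1. }
  fold S N in Havg.
  apply in_triangle in Hij.
  destruct (coef_le_sup_bidisk n c i j Hij) as (z & w & Hzw & Hle).
  exists (Cmod (poly_eval n c z w) / (S * eps)). split.
  - apply En_set_scaled; [now apply Rmult_lt_0_compat|exact Hbound|exact Hzw].
  - assert (HN0 : 0 < INR N) by (apply lt_0_INR; lia).
    assert (Hpow : 0 < INR n ^ (N - 1)) by now apply pow_lt.
    pose proof (exp_pos (INR n)).
    replace (INR (fact (N - 1)) / (INR N * (INR n ^ (N - 1) * exp (INR n))))
      with ((S / INR N) / (S * eps)) by (unfold eps; field; repeat split; lra).
    apply Rmult_le_compat_r; [left; apply Rinv_0_lt_compat, Rmult_lt_0_compat; lra|].
    eapply Rle_trans; [exact Havg|exact Hle].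
Qed.

Lemma En_lower_dimension_ln (alpha : R) (n : nat) :
  0 < alpha < 1 -> irrational alpha -> (1 <= n)%nat -> 2 < ln (INR n) ->
  exists t, En_set alpha n t /\ exp (INR n ^ 2 * ln (INR n) / 2 - INR n ^ 2) <= t.
Proof.
  intros Ha Hirr Hn Hln.
  destruct (En_lower_dimension alpha n Ha Hirr Hn) as (t & Ht & Hle).
  exists t. split; [exact Ht|]. eapply Rle_trans; [|exact Hle].
  pose proof (length_triangle n) as HN.
  set (N := length (triangle n)) in *.
  assert (HNpos : (2 <= N)%nat) by nia.
  assert (HN0 : 0 < INR N) by (apply lt_0_INR; lia).
  assert (Hx0 : 0 < INR n) by (apply lt_0_INR; lia).
  pose proof (ln_fact_ge (N - 1)) as Hf.
  assert (HM1 : 1 <= INR (N - 1)) by (apply (le_INR 1); lia).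
  assert (E : INR (fact (N - 1)) / (INR N * (INR n ^ (N - 1) * exp (INR n))) =
    exp (ln (INR (fact (N - 1))) - (ln (INR N) + (INR (N - 1) * ln (INR n) + INR n)))).
  { unfold Rminus. rewrite exp_plus, exp_Ropp, !exp_plus, !exp_ln by (try apply INR_fact_pos; assumption).
    rewrite <- ln_pow, exp_ln by (try apply pow_lt; assumption). reflexivity. }
  rewrite E. apply exp_le_compat.
  assert (EN : INR N = (INR n + 1) * (INR n + 2) / 2).
  { apply (f_equal INR) in HN. rewrite !mult_INR, !plus_INR in HN.
    change (INR 2) with (1 + 1) in HN. change (INR 1) with 1 in HN. lra. }
  assert (EM : INR (N - 1) = (INR n ^ 2 + 3 * INR n) / 2).
  { rewrite minus_INR by lia. rewrite EN. change (INR 1) with 1. field. }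
  set (x := INR n) in *.
  (* From [x > exp 2]. The value is just beyond the positive root, about 7.313, of the quadratic in
     [B4]. *)
  assert (Hx : 7.35 <= x).
  { rewrite <- (exp_ln x Hx0). apply Rle_trans with (exp 2); [|apply exp_le_compat; lra].
    eapply Rle_trans; [|apply (exp_ge_taylor 2 6); lra]. simpl. lra. }
  set (M := INR (N - 1)) in *.
  pose proof ln_2_le as L2.
  assert (B1 : M * (2 * ln x - 7 / 10) <= M * ln M).
  { apply Rmult_le_compat_l; [lra|].
    apply Rle_trans with (ln (x * x / 2)).
    - rewrite ln_div, ln_mult by nra. lra.
    - apply ln_le; [nra|]. rewrite EM. nra. }
  assert (B2 : ln (INR N) <= 2 * ln x).
  { apply Rle_trans with (ln (x * x)); [apply ln_le; [lra|]; rewrite EN; nra|].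
    rewrite ln_mult by lra. lra. }
  rewrite EM in *.
  set (L := ln x) in *.
  (* After [B1] and [B2] the claim reads [0 <= L (3 x / 2 - 2) + 0.15 x^2 - 3.55 x]; replacing [L]
     by 2 leaves [B4]. *)
  assert (B3 : 2 * (3 / 2 * x - 2) <= L * (3 / 2 * x - 2)) by (apply Rmult_le_compat_r; lra).
  assert (B4 : 0 <= 0.15 * x ^ 2 - 0.55 * x - 4) by nra.
  nra.
Qed.

(** Lets [(z^p - w^q)^m] be recognised as an element of [P_n] without computing its coefficients.
    The last constructor takes pointwise equality, so no extensionality of functions is required. *)
Inductive polyfun (n : nat) : (C -> C -> C) -> Prop :=
| polyfun_mono (a : C) (i j : nat) : (i + j <= n)%nat ->
    polyfun n (fun z w => a * (z ^ i * w ^ j))%C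
| polyfun_add (F G : C -> C -> C) : polyfun n F -> polyfun n G ->
    polyfun n (fun z w => F z w + G z w)%C
| polyfun_ext (F G : C -> C -> C) : polyfun n F -> (forall z w, F z w = G z w) ->
    polyfun n G.

Lemma polyfun_poly_eval (n : nat) (F : C -> C -> C) : polyfun n F ->
  exists c, forall z w, poly_eval n c z w = F z w.
Proof.
  induction 1 as [a i j Hij|F G _ [c1 H1] _ [c2 H2]|F G _ [c H] HFG].
  - exists (fun i' j' => if Nat.eq_dec i' i then if Nat.eq_dec j' j then a else RtoC 0 else RtoC 0).
    intros z w. rewrite poly_eval_triangle.
    rewrite (lsum_single _ _ (i, j)).
    + cbn [fst snd]. destruct (Nat.eq_dec i i), (Nat.eq_dec j j); [reflexivity|congruence..].
    + apply NoDup_triangle.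
    + now apply in_triangle.
    + intros [i' j'] _ Hne. cbn [fst snd].
      destruct (Nat.eq_dec i' i), (Nat.eq_dec j' j); try ring. congruence.
  - exists (fun i j => c1 i j + c2 i j)%C. intros z w.
    rewrite <- H1, <- H2, !poly_eval_triangle, <- lsum_plus.
    apply lsum_ext; intros x _. ring.
  - exists c. intros z w. now rewrite H.
Qed.

Lemma polyfun_mul_mono (n n' : nat) (F : C -> C -> C) (a : C) (i j : nat) :
  polyfun n F -> (i + j + n <= n')%nat ->
  polyfun n' (fun z w => a * (z ^ i * w ^ j) * F z w)%C.
Proof.
  intros HF Hn. induction HF as [b i' j' Hij|F G _ H1 _ H2|F G _ H HFG].
  - apply polyfun_ext with (fun z w => (a * b) * (z ^ (i + i') * w ^ (j + j')))%C.
    + apply polyfun_mono. lia.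
    + intros z w. rewrite !Cpow_add_r. ring.
  - eapply polyfun_ext; [exact (polyfun_add _ _ _ H1 H2)|]. intros z w; cbv beta; ring.
  - eapply polyfun_ext; [exact H|]. intros z w; simpl. now rewrite HFG.
Qed.

Lemma polyfun_binomial_pow (p q m : nat) : (p <= q)%nat ->
  polyfun (m * q) (fun z w => (z ^ p - w ^ q) ^ m)%C.
Proof.
  intros Hpq. induction m as [|m IH].
  - apply polyfun_ext with (fun z w => 1 * (z ^ 0 * w ^ 0))%C; [apply polyfun_mono; lia|].
    intros z w; simpl; ring.
  - apply polyfun_ext with (fun z w => 1 * (z ^ p * w ^ 0) * (z ^ p - w ^ q) ^ m +
      (- (1)) * (z ^ 0 * w ^ q) * (z ^ p - w ^ q) ^ m)%C.
    + apply polyfun_add; apply (polyfun_mul_mono (m * q)); try exact IH; simpl; lia.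
    + intros z w. rewrite (Cpow_S (z ^ p - w ^ q)). simpl Cpow at 2. simpl Cpow at 4. ring.
Qed.

Lemma polyfun_weaken (n n' : nat) (F : C -> C -> C) :
  polyfun n F -> (n <= n')%nat -> polyfun n' F.
Proof.
  intros HF Hn. eapply polyfun_ext; [apply (polyfun_mul_mono n n' F (RtoC 1) 0 0 HF); lia|].
  intros z w; simpl; ring.
Qed.

(** Makes the set inhabited and gives [E >= 1], which settles every nonpositive lower bound for
    [ln E]. *)
Lemma En_set_one (alpha : R) (n : nat) : En_set alpha n 1.
Proof.
  destruct (polyfun_poly_eval n _ (polyfun_mono n (RtoC 1) 0 0 ltac:(lia))) as (c & Hc).
  assert (Hc1 : forall z w, poly_eval n c z w = RtoC 1) by (intros; rewrite Hc; simpl; now rewrite !Cmult_1_l).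
  exists c. split.
  - intros z w _. rewrite Hc1. apply Req_le, Cmod_1.
  - exists (RtoC 0), (RtoC 0). split.
    + split; apply Rle_trans with 0; try lra; apply Req_le, Cmod_0.
    + rewrite Hc1. symmetry; apply Cmod_1.
Qed.

Lemma Rabs_theta_le (alpha : R) (s : nat) : irrational alpha ->
  Rabs (theta alpha s) <= / IZR (cf_q alpha (S s)).
Proof.
  intros Hirr. replace (theta alpha s) with (thetam alpha (S s))
    by (unfold theta, thetam; now rewrite cf_qm_S, cf_pm_S).
  now apply Rabs_thetam.
Qed.

Lemma exp_half_le_2 : exp (1 / 2) <= 2.
Proof.
  pose proof exp_le_3 as H. replace 1 with (1 / 2 + 1 / 2) in H at 1 by field.
  rewrite exp_plus in H. pose proof (exp_pos (1 / 2)). nra.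
Qed.

(* The polynomial [(z^p - w^q)^(n/q)] at the convergent [p/q = p_s/q_s]. *)
Lemma En_lower_convergent (alpha : R) (s n : nat) :
  0 < alpha < 1 -> irrational alpha -> (2 <= cf_q alpha (S s))%Z ->
  exists t, En_set alpha n t /\
    exp (IZR (Z.of_nat n / cf_q alpha s) * ln (IZR (cf_q alpha (S s))) - INR n) <= t.
Proof.
  intros Ha Hirr HQ.
  pose proof (cf_q_pos alpha s Hirr) as Hq.
  pose proof (Rabs_theta_le alpha s Hirr) as Hth.
  set (Q := IZR (cf_q alpha (S s))) in *.
  assert (HQ' : 2 <= Q) by (apply (IZR_le 2); assumption).
  assert (HQinv : 0 < / Q <= 1 / 2).
  { split; [apply Rinv_0_lt_compat; lra|]. unfold Rdiv; rewrite Rmult_1_l. apply Rinv_le_contravar; lra. }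
  (* Makes [z^p - w^q] a polynomial of degree [q]. It follows from [0 < alpha < 1] because
     [|theta| < 1]. *)
  assert (Hpq : (0 <= cf_p alpha s <= cf_q alpha s)%Z).
  { assert (Hth' : Rabs (theta alpha s) < 1) by lra. apply Rabs_def2 in Hth'. unfold theta in Hth'.
    pose proof (IZR_le _ _ Hq).
    split; [apply Z.lt_succ_r with (m := cf_p alpha s)|apply Z.lt_succ_r]; apply lt_IZR;
      rewrite succ_IZR; nra. }
  set (p := Z.to_nat (cf_p alpha s)). set (q := Z.to_nat (cf_q alpha s)).
  assert (Ep : IZR (cf_p alpha s) = INR p) by (rewrite INR_IZR_INZ; f_equal; lia).
  assert (Eq : IZR (cf_q alpha s) = INR q) by (rewrite INR_IZR_INZ; f_equal; lia).
  set (m := (n / q)%nat).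
  assert (Hmq : (m * q <= n)%nat) by (rewrite Nat.mul_comm; apply Nat.Div0.mul_div_le).
  assert (Em : IZR (Z.of_nat n / cf_q alpha s) = INR m).
  { rewrite INR_IZR_INZ. unfold m. rewrite Nat2Z.inj_div. f_equal. unfold q. rewrite Z2Nat.id by lia. reflexivity. }
  destruct (polyfun_poly_eval n _ (polyfun_weaken _ n _ (polyfun_binomial_pow p q m ltac:(lia)) Hmq))
    as (c & Hc).
  (* Bound for [z^p - w^q] on the curve: [exp (p u)] has modulus at most [exp p], and
     [exp (theta u) - 1] at most [|theta| exp |theta| <= 2 / Q]. *)
  set (b := 2 * exp (INR p) / Q).
  pose proof (exp_pos (INR p)) as Hexp.
  assert (Hb : 0 < b) by (apply Rdiv_lt_0_compat; lra).
  assert (Hq0 : 0 < INR q) by (apply lt_0_INR; lia).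
  (* Here [w^q = -1], so [z^p - w^q = 2], which cancels the 2 in [b]. *)
  set (z := RtoC 1). set (w := cexp (0, PI / INR q)).
  assert (Hval : Cmod (poly_eval n c z w) = 2 ^ m).
  { rewrite Hc, Cmod_pow. f_equal. unfold z, w. rewrite Cpow_1_l, cexp_pow.
    replace (cexp (INR q * (0, (PI / INR q)%R))%C) with (RtoC (- (1))).
    - rewrite <- RtoC_minus, Cmod_R. replace (1 - - (1)) with 2 by ring. apply Rabs_pos_eq; lra.
    - unfold cexp, Cexp, Cmult, RtoC; cbn [fst snd].
      replace (INR q * 0 - 0 * (PI / INR q)) with 0 by ring.
      replace (INR q * (PI / INR q) + 0 * 0) with PI by (field; lra).
      rewrite exp_0, cos_PI, sin_PI. f_equal; ring. }
  exists (Cmod (poly_eval n c z w) / b ^ m). split.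
  - apply En_set_scaled; [now apply pow_lt| |].
    + intros u Hu. rewrite <- poly_eval_curve, Hc, Cmod_pow. apply pow_incr.
      split; [apply Cmod_ge_0|].
      change (Cmod (cexp u ^ p - cexp (Cscal alpha u) ^ q)%C <= b).
      (* Since [q alpha = p + theta], the factor [exp (p u)] comes out; [texp 1] is the constant 1,
         so [cexp_taylor] with one term applies. *)
      replace (cexp u ^ p - cexp (Cscal alpha u) ^ q)%C
        with (- (cexp (INR p * u) * (cexp (theta alpha s * u) - texp 1 (theta alpha s * u))))%C.
      * rewrite Cmod_opp, Cmod_mult, Cmod_cexp, fst_scal.
        pose proof (cexp_taylor 1 (theta alpha s * u)%C) as Ht.
        assert (Hd : Cmod (theta alpha s * u)%C <= / Q).
        { rewrite Cmod_mult, Cmod_R. pose proof (Rabs_pos (theta alpha s)).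
          pose proof (Cmod_ge_0 u). nra. }
        set (d := Cmod (theta alpha s * u)%C) in *.
        assert (Hd0 : 0 <= d) by apply Cmod_ge_0.
        assert (Hed : exp d <= 2).
        { eapply Rle_trans; [apply exp_le_compat with (y := 1 / 2); lra|apply exp_half_le_2]. }
        simpl in Ht. rewrite Rmult_1_r, Rdiv_1_r in Ht.
        assert (Hep : exp (INR p * fst u) <= exp (INR p)).
        { apply exp_le_compat. pose proof (Re_le_Cmod u). pose proof (pos_INR p). nra. }
        apply Rle_trans with (exp (INR p) * (/ Q * 2)); [|right; unfold b; field; lra].
        apply Rmult_le_compat; [left; apply exp_pos|apply Cmod_ge_0|exact Hep|].
        eapply Rle_trans; [exact Ht|]. pose proof (exp_pos d). apply Rmult_le_compat; lra.
      * replace (texp 1 (theta alpha s * u)%C) with (RtoC 1) by (unfold texp; simpl; field).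
        rewrite !cexp_pow.
        replace (INR q * Cscal alpha u)%C with (INR p * u + theta alpha s * u)%C.
        -- rewrite cexp_add. ring.
        -- unfold theta. rewrite Ep, Eq. unfold Cscal, Cmult, Cplus, RtoC; cbn [fst snd]. f_equal; ring.
    + split.
      * apply Req_le, Cmod_1.
      * apply Req_le. change (Cmod w = 1). unfold w. rewrite Cmod_cexp. apply exp_0.
  - rewrite Hval, Em.
    replace (2 ^ m / b ^ m) with (exp (INR m * (ln Q - INR p))).
    + apply exp_le_compat. apply le_INR in Hmq. rewrite mult_INR in Hmq.
      assert (INR p <= INR q) by (apply le_INR; lia). pose proof (pos_INR m). nra.
    + transitivity ((Q / exp (INR p)) ^ m).
      * rewrite <- (exp_ln (Q / exp (INR p))) by (apply Rdiv_lt_0_compat; lra).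
        rewrite ln_div, ln_exp by lra.
        rewrite <- (exp_ln (exp (ln Q - INR p) ^ m)) by (apply pow_lt, exp_pos).
        rewrite ln_pow, ln_exp by apply exp_pos. reflexivity.
      * unfold Rdiv at 2. rewrite <- pow_inv, <- Rpow_mult_distr. f_equal.
        unfold b. field. split; lra.
Qed.

Theorem theorem1 (alpha : R) (s n : nat)
  (Halpha : 0 < alpha < 1)
  (Hirr : forall (p : Z) (q : Z), (q <> 0)%Z -> alpha <> IZR p / IZR q)
  (Hn : (1 <= n)%nat)
  (Hlo : (cf_q alpha s <= Z.of_nat n)%Z)
  (Hhi : (Z.of_nat n < cf_q alpha (S s))%Z) :
  exists E : R, is_lub (En_set alpha n) E /\ 0 < E /\
    Rmax (INR n ^ 2 * ln (INR n) / 2 - INR n ^ 2)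
         (IZR (Z.of_nat n / cf_q alpha s) * ln (IZR (cf_q alpha (S s))) - INR n)
      <= ln E /\
    ln E <= INR n ^ 2 * ln (INR n) / 2 + 9 * INR n ^ 2
            + INR n / IZR (cf_q alpha s) * ln (IZR (cf_q alpha (S s))).
Proof.
  destruct (completeness (En_set alpha n)) as (E & HE).
  { eexists. intros t Ht. exact (En_upper alpha s n t Halpha Hirr Hn Hlo Hhi Ht). }
  { exists 1. apply En_set_one. }
  destruct HE as [Hub Hleast].
  assert (HE1 : 1 <= E) by apply Hub, En_set_one.
  assert (Hlower : forall b, (exists t, En_set alpha n t /\ exp b <= t) -> b <= ln E).
  { intros b (t & Ht & Hbt). rewrite <- (ln_exp b). apply ln_le; [apply exp_pos|].
    apply Rle_trans with (1 := Hbt). now apply Hub. }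
  exists E. split; [now split|]. split; [lra|]. split.
  - apply Rmax_lub; apply Hlower.
    (* If [ln n <= 2] the bound is nonpositive and the value 1 suffices. *)
    + destruct (Rlt_le_dec 2 (ln (INR n))) as [Hln|Hln].
      * now apply En_lower_dimension_ln.
      * exists 1. split; [apply En_set_one|]. rewrite <- exp_0. apply exp_le_compat.
        pose proof (pow2_ge_0 (INR n)). nra.
    + apply En_lower_convergent; [assumption..|lia].
  - set (U := _ + _). rewrite <- (ln_exp U). apply ln_le; [lra|].
    apply Hleast. intros t Ht. now apply (En_upper alpha s n t).
Qed.
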